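(* Consider the random field Ising model with bimodal field in dimension $d\ge1$. There exist $\epsilon_d>0$ and a function $\tilde H_1$ on $[0,\beta_c(d))$ with values $$\tilde H_1(\beta)\ \begin{cases}=\infty, & \beta\in[0,\beta_P(d)],\\ \in(0,\infty), & \beta\in(\beta_P(d),\beta_P(d)+\epsilon_d],\\ \in[0,\infty), & \beta\in(\beta_P(d)+\epsilon_d,\beta_c(d)),\end{cases}$$ such that for each $\beta\in[0,\beta_c(d))$ and each $H\in[0,\tilde H_1(\beta))$ (a vacuous condition when $\tilde H_1(\beta)=0$) there is a constant $C_1(\beta,H)\in(0,\infty)$ depending only on $\beta,H$ (and $d$) with the following property: for all finite subsets $\Delta\subseteq\Lambda$ of $\mathbb{Z}^d$ and every realization $\vec h\in\{-1,+1\}^\Lambda$, $$\sup_{\eta,\eta'\in\{-1,+1\}^{\partial_{ex}\Lambda}}TV\left(P^{\vec h}_{\Lambda,\eta,\beta,H}(\sigma_\Delta\in\cdot),P^{\vec h}_{\Lambda,\eta',\beta,H}(\sigma_\Delta\in\cdot)\right)\le\sum_{x\in\partial_{ex}\Delta,\,y\in\partial_{ex}\Lambda}e^{-C_1(\beta,H)|x-y|}.$$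
   Context: For a finite $\Lambda\subseteq\mathbb{Z}^d$, $\partial_{ex}\Lambda$ is the set of vertices of $\mathbb{Z}^d\setminus\Lambda$ having a nearest neighbor in $\Lambda$. For $\beta\ge0$, $H\ge 0$, $\eta\in\{-1,+1\}^{\partial_{ex}\Lambda}$ and $\vec h\in\mathbb{R}^\Lambda$, $P^{\vec h}_{\Lambda,\eta,\beta,H}$ is the probability measure on $\{-1,+1\}^\Lambda$ given by $$P^{\vec h}_{\Lambda,\eta,\beta,H}(\sigma)\propto\exp\Big[\beta\sum_{\{u,v\}}\sigma_u\sigma_v+\beta\sum_{\{u,v\}:u\in\Lambda,v\in\partial_{ex}\Lambda}\sigma_u\eta_v+H\sum_{u\in\Lambda}h_u\sigma_u\Big],$$ where the first sum is over (unordered) nearest neighbor pairs in $\Lambda$ and the second over nearest neighbor pairs. In the random field Ising model (RFIM), $\vec h$ is a realization of i.i.d. random variables $H_u$ of mean $0$ and variance $1$; the bimodal field has $\mathrm{Prob}(H_u=+1)=\mathrm{Prob}(H_u=-1)=1/2$, so $\vec h$ takes values in $\{-1,+1\}^\Lambda$. $\sigma_\Delta$ is the restriction of $\sigma$ to $\Delta$, $TV$ is total variation distance, $|\cdot|$ is the Euclidean norm. $\beta_c(d)$ is the critical inverse temperature of the (homogeneous, nearest neighbor) Ising model on $\mathbb{Z}^d$ with $H=0$. $\beta_P(d)$ is defined by $1-e^{-2\beta_P(d)}=p_c^b(d)$, where $p_c^b(d)$ is the critical probability of independent Bernoulli bond percolation on $\mathbb{Z}^d$. When $d=1$, $\beta_P(1)=\beta_c(1)=\infty$,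 so only the first case (all $\beta\in[0,\infty)$) occurs. *)

(* Defs.v *)
From HB Require Import structures.
From mathcomp Require Import all_boot all_order all_algebra.
From mathcomp Require Import finmap.
From mathcomp Require Import all_classical all_reals all_analysis.

Set Implicit Arguments.
Unset Strict Implicit.
Unset Printing Implicit Defensive.

Import Order.TTheory GRing.Theory Num.Theory.
Import numFieldNormedType.Exports.

Local Open Scope classical_set_scope.
Local Open Scope ring_scope.

Definition site (d : nat) := 'rV[int]_d.

Definition unit_vec d (i : 'I_d) : site d := delta_mx 0 i.

Definition neighbours d (x : site d) : {fset site d} :=
  ([fset (x + unit_vec i)%R | i in 'I_d] `|` [fset (x - unit_vec i)%R | i in 'I_d])%fset.

Definition nn d (x y : site d) : bool := y \in neighbours x.

Definition ext_boundary d (L : {fset site d}) : {fset site d} :=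
  ((\bigcup_(x <- L) neighbours x) `\` L)%fset.

Definition eucl_dist (R : realType) d (x y : site d) : R :=
  Num.sqrt (\sum_(i < d) ((x 0 i - y 0 i)%:~R ^+ 2)).

(* A spin configuration is a bool-valued function; true stands for +1 and
   false for -1. *)
Definition spins d (L : {fset site d}) := {ffun L -> bool}.

Definition spin (R : realType) (b : bool) : R := if b then 1 else -1.

(* The first sum runs over ordered pairs, so each unordered pair is counted
   twice, whence the factor 1/2. *)
Definition gibbs_exponent (R : realType) d (L : {fset site d})
    (h : L -> R) (eta : spins (ext_boundary L)) (beta H : R) (s : spins L) : R :=
  beta * (2^-1 * \sum_(u : L) \sum_(v : L | nn (val u) (val v))
                   spin R (s u) * spin R (s v))
  + beta * (\sum_(u : L) \sum_(v : ext_boundary L | nn (val u) (val v))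
                   spin R (s u) * spin R (eta v))
  + H * \sum_(u : L) h u * spin R (s u).

Definition gibbs_weight (R : realType) d (L : {fset site d})
    (h : L -> R) (eta : spins (ext_boundary L)) (beta H : R) (s : spins L) : R :=
  expR (gibbs_exponent h eta beta H s).

Definition gibbs (R : realType) d (L : {fset site d})
    (h : L -> R) (eta : spins (ext_boundary L)) (beta H : R) (s : spins L) : R :=
  gibbs_weight h eta beta H s / \sum_(t : spins L) gibbs_weight h eta beta H t.

Definition restrict_spins d (D L : {fset site d}) (sDL : (D `<=` L)%fset)
    (s : spins L) : spins D :=
  [ffun x => s (fincl sDL x)].

Definition gibbs_marginal (R : realType) d (D L : {fset site d})
    (sDL : (D `<=` L)%fset) (h : L -> R) (eta : spins (ext_boundary L))
    (beta H : R) (A : {set spins D}) : R :=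
  \sum_(s : spins L | restrict_spins sDL s \in A) gibbs h eta beta H s.

Definition tv_dist (R : realType) (T : finType) (mu nu : {set T} -> R) : R :=
  \big[Num.max/0]_(A : {set T}) `|mu A - nu A|.

(* The supremum over the finitely many pairs of boundary conditions; all terms
   are nonnegative, so the default value 0 of the maximum is harmless. *)
Definition max_bc_tv (R : realType) d (D L : {fset site d})
    (sDL : (D `<=` L)%fset) (h : L -> R) (beta H : R) : R :=
  \big[Num.max/0]_(eta : spins (ext_boundary L))
  \big[Num.max/0]_(eta' : spins (ext_boundary L))
    tv_dist (gibbs_marginal sDL h eta beta H) (gibbs_marginal sDL h eta' beta H).

(* [-n, n]^d *)
Definition box d (n : nat) : {fset site d} :=
  [fset (\row_(i < d) ((k i)%:Z - n%:Z))%R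
  | k : {ffun 'I_d -> 'I_(n.*2.+1)} in {: {ffun 'I_d -> 'I_(n.*2.+1)}}]%fset.

Lemma in_box d n (x : site d) : (x \in box d n) = [forall i, `|x 0 i| <= n%:Z].
Proof.
apply/imfsetP/forallP => /= [[k _ ->] i|xn].
  rewrite mxE ler_norml lerBrDr addNr lerBlDr -PoszD addnn.
  by apply/andP; split=> //; rewrite lez_nat -ltnS ltn_ord.
have P i : (`|(x 0 i + n%:Z)%R|%N < n.*2.+1)%N.
  have := xn i; rewrite ler_norml => /andP[x1 x2].
  rewrite ltnS -lez_nat gez0_abs -?addnn ?PoszD ?lerD2r//.
  by rewrite -lerBlDr sub0r.
exists [ffun i => Ordinal (P i)] => //.
apply/rowP => i; rewrite mxE ffunE /= gez0_abs ?addrK//.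
by have := xn i; rewrite ler_norml => /andP[x1 _]; rewrite -lerBlDr sub0r.
Qed.

Lemma origin_box d n : 0 \in box d n.
Proof. by rewrite in_box; apply/forallP => i; rewrite mxE normr0. Qed.

(* The expectation of the spin at the origin in the box [-n, n]^d with plus
   boundary condition and no external field. *)
Definition plus_magnetization (R : realType) d (beta : R) (n : nat) : R :=
  \sum_(s : spins (box d n))
    gibbs (fun=> 0) [ffun=> true] beta 0 s * spin R (s [` origin_box d n]%fset).

Definition spontaneous_magnetization (R : realType) d (beta : R) : R :=
  lim (plus_magnetization d beta n @[n --> \oo]).

(* Equal to +oo when there is no spontaneous magnetization at any beta. *)
Definition beta_c (R : realType) (d : nat) : \bar R :=
  ereal_inf [set beta%:E | beta in
    [set beta : R | 0 <= beta /\ 0 < spontaneous_magnetization d beta]].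

(* The pair (x, i) stands for the unoriented bond {x, x + e_i}; every
   nearest-neighbour bond of Z^d is represented exactly once. *)
Definition bond d := (site d * 'I_d)%type.

Definition bond_config d := bond d -> bool.

Definition bond_cylinders d : set (set (bond_config d)) :=
  [set [set w : bond_config d | w e] | e in setT].

Definition bond_space d := g_sigma_algebraType (@bond_cylinders d).

Definition bernoulli_product (R : realType) d (p : R)
    (P : probability (bond_space d) R) : Prop :=
  forall (F : {fset bond d}) (w0 : bond_config d),
    P [set w | forall e, e \in F -> w e = w0 e] =
    (\prod_(e <- F) (if w0 e then p else 1 - p))%:E.

Definition open_step d (w : bond_config d) (x y : site d) : bool :=
  [exists i, ((y == x + unit_vec i) && w (x, i))
          || ((x == y + unit_vec i) && w (y, i))].

Definition open_cluster d (w : bond_config d) (x : site d) : set (site d) :=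
  [set y | exists2 s : seq (site d), path (open_step w) x s & y = last x s].

Definition origin_percolates d : set (bond_space d) :=
  [set w | infinite_set (open_cluster w 0)].

Definition p_c (R : realType) (d : nat) : R :=
  sup [set p : R | 0 <= p <= 1 /\
    exists2 P : probability (bond_space d) R,
      bernoulli_product p P & P (@origin_percolates d) = 0%E].

(* The solution of 1 - exp (- 2 b) = p_c in extended reals, see beta_P_eq;
   lne 0 = -oo, so that it is +oo when p_c = 1. *)
Definition beta_P (R : realType) (d : nat) : \bar R :=
  (- (2^-1%:E * lne (1 - p_c R d)%:E))%E.

Lemma mem_ext_boundary d (L : {fset site d}) y :
  (y \in ext_boundary L) <-> y \notin L /\ exists2 x, x \in L & nn x y.
Proof.
rewrite /ext_boundary in_fsetD; split.
  by case/andP=> yL /bigfcupP[x /andP[xL _] xy]; split=> //; exists x.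
by case=> yL [x xL xy]; rewrite yL; apply/bigfcupP; exists x; rewrite ?xL.
Qed.

Lemma gibbs_sum1 (R : realType) d (L : {fset site d}) (h : L -> R) eta beta H :
  \sum_(s : spins L) gibbs h eta beta H s = 1.
Proof.
rewrite /gibbs -mulr_suml divff// gt_eqF//.
rewrite (bigD1 [ffun=> true])//= ltr_pwDl ?expR_gt0//.
by apply: sumr_ge0 => s _; exact: expR_ge0.
Qed.

Lemma p_c_le1 (R : realType) d : p_c R d <= 1.
Proof.
rewrite /p_c; set S := [set p | _].
have [->|/set0P S0] := eqVneq S set0; first by rewrite sup0.
by apply: ge_sup => // p [/andP[]].
Qed.

Lemma beta_P_eq (R : realType) d :
  (1 - expeR (- (2%:E * beta_P R d)))%E = (p_c R d)%:E.
Proof.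
rewrite /beta_P muleN oppeK muleA -EFinM divff ?pnatr_eq0// mul1e lneK.
  by rewrite -EFinB opprB addrC subrK.
by rewrite in_itv/= leey andbT lee_fin subr_ge0 p_c_le1.
Qed.

(* Main.v *)
Require Import Defs.
From HB Require Import structures.
From mathcomp Require Import all_boot all_order all_algebra.
From mathcomp Require Import finmap.
From mathcomp Require Import all_classical all_reals all_analysis.
From mathcomp Require Import zify ring lra.

Set Implicit Arguments.
Unset Strict Implicit.
Unset Printing Implicit Defensive.

Import Order.TTheory GRing.Theory Num.Theory.
Import numFieldNormedType.Exports.

Local Open Scope ring_scope.

(* In the Edwards-Sokal representation, explore bond by bond the set of sites
   joined to the boundary, simultaneously for two boundary conditions. Once the
   exploration stops, the unexplored spins see no boundary condition at all, so
   that the total variation distance is at most the probability that the explored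
   set meets Delta. A queried bond always leads to a spin not reached so far; by
   finite energy that spin is misaligned with probability bounded below, so the
   bond is open with probability at most a rate p'(beta, H) strictly smaller than
   1 - exp (- 2 beta), uniformly in the field. Hence disagreement is dominated by
   Bernoulli percolation with parameter p'(beta, H), which is subcritical for
   beta <= beta_P and every H and, by continuity, for beta slightly above beta_P
   and H <= 1.

   Subcritical percolation decays exponentially by the argument of Duminil-Copin
   and Tassion: unless some finite S has phi_q(S) < 1, the probability theta that
   the origin leaves a box satisfies theta' >= 1 - theta (Russo's formula), which
   forces percolation at every larger parameter; and phi_q(S) < 1 implies decay by
   iterating a Simon-Lieb inequality. Parameters below 1 / (2 d) satisfy the
   criterion with S a point, so p_c > 0 is never needed. The same decay kills the
   magnetization up to beta_P + 2 eps, hence beta_P + eps < beta_c. *)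

(** * Weighted sums over configurations *)

Definition upd (T : eqType) (w : T -> bool) (x : T) (b : bool) : T -> bool :=
  fun y => if y == x then b else w y.

Section Upd.
Variables (T : eqType).
Implicit Types (w : T -> bool) (x y : T).

Lemma upd_same w x b : upd w x b x = b.
Proof. by rewrite /upd eqxx. Qed.

Lemma upd_id w x : upd w x (w x) = w.
Proof. by apply: funext => y; rewrite /upd; case: eqP => [->|]. Qed.

Lemma upd_upd w x b c : upd (upd w x b) x c = upd w x c.
Proof. by apply: funext => y; rewrite /upd; case: eqP. Qed.

Lemma updC w x y b c : x != y -> upd (upd w x b) y c = upd (upd w y c) x b.
Proof.
move=> xy; apply: funext => z; rewrite /upd; have [->|//] := eqVneq z y.
by rewrite eq_sym (negPf xy).
Qed.

End Upd.

(* Sum over the values on [l] of a configuration that agrees with [w] off [l],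
   of weight [a] per [true] and [b] per [false]; with [a = b = 1] the coordinates
   are spins, with [b = 1 - a] independent bonds. *)
Fixpoint wsum (R : pzRingType) (T : eqType) (a b : R) (l : seq T)
    (f : (T -> bool) -> R) (w : T -> bool) : R :=
  if l is x :: l' then
    a * wsum a b l' f (upd w x true) + b * wsum a b l' f (upd w x false)
  else f w.

Definition depends_on (T : eqType) (X : Type) (I : T -> Prop)
    (f : (T -> bool) -> X) : Prop :=
  forall v w, (forall x, I x -> v x = w x) -> f v = f w.

Section WsumRing.
Variables (R : comPzRingType) (T : eqType) (a b : R).
Implicit Types (l : seq T) (f g : (T -> bool) -> R) (w : T -> bool).

(** Comparison by coupling: both sums write the same value at each coordinate, so a relation stable
    under simultaneous updates still holds where [f] and [g] are evaluated. *)
Lemma eq_wsum_rel (Q : (T -> bool) -> (T -> bool) -> Prop) l f g v w :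
  (forall v w x c, x \in l -> Q v w -> Q (upd v x c) (upd w x c)) ->
  (forall v w, Q v w -> f v = g w) -> Q v w ->
  wsum a b l f v = wsum a b l g w.
Proof.
move=> Qupd Qfg; elim: l Qupd v w => /= [_|x l IH Qupd] v w vw.
  exact: Qfg.
have Ql v' w' y c : y \in l -> Q v' w' -> Q (upd v' y c) (upd w' y c).
  by move=> yl; apply: Qupd; rewrite in_cons yl orbT.
by congr (_ * _ + _ * _); apply: IH => //; apply: Qupd => //; rewrite mem_head.
Qed.

Lemma eq_wsum_in l f g w :
  (forall v, (forall x, x \notin l -> v x = w x) -> f v = g v) ->
  wsum a b l f w = wsum a b l g w.
Proof.
move=> fg; apply: (@eq_wsum_rel
  (fun v v' => v = v' /\ forall x, x \notin l -> v x = w x)) => //.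
- move=> v _ x c xl [<- vw]; split=> // y yl; rewrite /upd.
  by have [yx|_] := eqVneq y x; [move: yl; rewrite yx xl|exact: vw].
- by move=> v _ [<- vw]; exact: fg.
Qed.

Lemma eq_wsum l f g w : f =1 g -> wsum a b l f w = wsum a b l g w.
Proof. by move=> fg; elim: l w => //= x l IH w; rewrite !IH. Qed.

Lemma wsumD l f g w :
  wsum a b l (fun v => f v + g v) w = wsum a b l f w + wsum a b l g w.
Proof. by elim: l w => //= x l IH w; rewrite !IH !mulrDr addrACA. Qed.

Lemma wsumZ l c f w : wsum a b l (fun v => c * f v) w = c * wsum a b l f w.
Proof. by elim: l w => //= x l IH w; rewrite !IH mulrDr !(mulrCA c). Qed.

Lemma wsumB l f g w :
  wsum a b l (fun v => f v - g v) w = wsum a b l f w - wsum a b l g w.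
Proof.
rewrite wsumD; congr (_ + _); rewrite -mulN1r -wsumZ.
by apply: eq_wsum => v; rewrite mulN1r.
Qed.

Lemma wsum_sum (I : Type) (r : seq I) (P : pred I)
    (F : I -> (T -> bool) -> R) l w :
  wsum a b l (fun v => \sum_(i <- r | P i) F i v) w =
  \sum_(i <- r | P i) wsum a b l (F i) w.
Proof.
elim: l w => //= x l IH w.
by rewrite !IH !mulr_sumr -big_split.
Qed.

Lemma wsum_cat l1 l2 f w :
  wsum a b (l1 ++ l2) f w = wsum a b l1 (wsum a b l2 f) w.
Proof. by elim: l1 w => //= x l IH w; rewrite !IH. Qed.

(** The coordinates can be summed in any order, so an exploration may query whichever bond it likes
    next. *)
Lemma wsum_peel l x f w : x \in l ->
  wsum a b l f w = a * wsum a b (rem x l) f (upd w x true)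
                   + b * wsum a b (rem x l) f (upd w x false).
Proof.
elim: l w => //= y l IH w; rewrite in_cons; have [->|yx] := eqVneq y x.
  by [].
move=> xl; rewrite !IH//= !(updC _ _ _ yx) !mulrDr !(mulrCA b a) -!addrA.
by congr (_ + _); rewrite addrCA.
Qed.

Lemma perm_wsum l1 l2 f w : perm_eq l1 l2 -> wsum a b l1 f w = wsum a b l2 f w.
Proof.
elim: l1 l2 w => [|x l IH] l2 w.
  by move=> /perm_size /esym/eqP; rewrite size_eq0 => /eqP ->.
move=> p; have xl2 : x \in l2 by rewrite -(perm_mem p) mem_head.
have pl : perm_eq l (rem x l2).
  by rewrite -(perm_cons x); apply: perm_trans p _; apply: perm_to_rem.
by rewrite (wsum_peel _ _ xl2) /= !(IH _ _ pl).
Qed.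

Lemma wsum_upd_out l x c f w : x \notin l ->
  wsum a b l f (upd w x c) = wsum a b l (fun v => f (upd v x c)) w.
Proof.
elim: l w => //= y l IH w; rewrite in_cons negb_or => /andP[xy xl].
by rewrite !(updC _ _ _ xy) !IH.
Qed.

Lemma wsum_depends l (I : T -> Prop) f v w : depends_on I f ->
  (forall x, I x -> x \notin l -> v x = w x) ->
  wsum a b l f v = wsum a b l f w.
Proof.
move=> If; elim: l v w => /= [|x l IH] v w vw.
  by apply: If => x Ix; exact: vw.
have agree c y : I y -> y \notin l -> upd v x c y = upd w x c y.
  move=> Iy yl; rewrite /upd; have [//|yx] := eqVneq y x.
  by apply: vw => //; rewrite in_cons negb_or yx.
by congr (_ * _ + _ * _); apply: IH => y; apply: agree.
Qed.

Hypothesis ab1 : a + b = 1.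

Lemma wsum_const l c w : wsum a b l (fun=> c) w = c.
Proof. by elim: l w => //= x l IH w; rewrite !IH -mulrDl ab1 mul1r. Qed.

(** Coordinates that [f] ignores integrate to the total mass [a + b = 1]. *)
Lemma wsum_out l (I : T -> Prop) f w : depends_on I f ->
  (forall x, x \in l -> ~ I x) -> wsum a b l f w = f w.
Proof.
move=> If; elim: l w => //= x l IH w lI.
rewrite !IH; last 2 first.
- by move=> y yl; apply: lI; rewrite in_cons yl orbT.
- by move=> y yl; apply: lI; rewrite in_cons yl orbT.
have u c : f (upd w x c) = f w.
  apply: If => y Iy; rewrite /upd; have [yx|//] := eqVneq y x.
  by case: (lI x); rewrite ?mem_head// -yx.
by rewrite !u -mulrDl ab1 mul1r.
Qed.

End WsumRing.

Section WsumOrder.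
Variables (R : numDomainType) (T : eqType) (a b : R).
Implicit Types (l : seq T) (f g : (T -> bool) -> R) (w : T -> bool).
Hypotheses (a0 : 0 <= a) (b0 : 0 <= b).

Lemma wsum_le_rel (Q : (T -> bool) -> (T -> bool) -> Prop) l f g v w :
  (forall v w x c, x \in l -> Q v w -> Q (upd v x c) (upd w x c)) ->
  (forall v w, Q v w -> f v <= g w) -> Q v w ->
  wsum a b l f v <= wsum a b l g w.
Proof.
move=> Qupd Qfg; elim: l Qupd v w => /= [_|x l IH Qupd] v w vw.
  exact: Qfg.
have Ql v' w' y c : y \in l -> Q v' w' -> Q (upd v' y c) (upd w' y c).
  by move=> yl; apply: Qupd; rewrite in_cons yl orbT.
by rewrite lerD// ler_wpM2l// IH//; apply: Qupd => //; rewrite mem_head.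
Qed.

Lemma ler_wsum_in l f g w :
  (forall v, (forall x, x \notin l -> v x = w x) -> f v <= g v) ->
  wsum a b l f w <= wsum a b l g w.
Proof.
move=> fg; apply: (@wsum_le_rel
  (fun v v' => v = v' /\ forall x, x \notin l -> v x = w x)) => //.
- move=> v _ x c xl [<- vw]; split=> // y yl; rewrite /upd.
  by have [yx|_] := eqVneq y x; [move: yl; rewrite yx xl|exact: vw].
- by move=> v _ [<- vw]; exact: fg.
Qed.

Lemma ler_wsum l f g w : (forall v, f v <= g v) ->
  wsum a b l f w <= wsum a b l g w.
Proof.
move=> fg; apply: (@wsum_le_rel eq) => //.
  by move=> v v' x c _ ->.
by move=> v v' ->.
Qed.

Lemma wsum_ge0 l f w : (forall v, 0 <= f v) -> 0 <= wsum a b l f w.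
Proof.
move=> f0; elim: l w => //= x l IH w.
by rewrite addr_ge0// mulr_ge0.
Qed.

Lemma wsum_monotone l f (v w : T -> bool) :
  (forall v w : T -> bool, (forall x, v x -> w x) -> f v <= f w) ->
  (forall x, v x -> w x) -> wsum a b l f v <= wsum a b l f w.
Proof.
move=> fmono.
apply: (wsum_le_rel (Q := fun v w : T -> bool => forall x, v x -> w x)) => //.
move=> {}v {}w x c _ vw y; rewrite /upd; case: eqP => // _; exact: vw.
Qed.

End WsumOrder.

Lemma wsum_gt0 (R : numDomainType) (T : eqType) (a b : R) (l : seq T) f w :
  0 < a -> 0 < b -> (forall v, 0 < f v) -> 0 < wsum a b l f w.
Proof.
move=> a0 b0 f0; elim: l w => //= x l IH w.
by rewrite addr_gt0// mulr_gt0.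
Qed.

(** * Percolation on finitely many bonds *)

Section Connectivity.
Variables (V E : eqType) (src tgt : E -> V).
Implicit Types (w : E -> bool) (A B D : V -> Prop) (e : E) (x y : V).

Definition joins e x y : Prop :=
  (src e = x /\ tgt e = y) \/ (src e = y /\ tgt e = x).

(** The cluster grows from a set of sources, not a point: the explorations below absorb a vertex
    into this set each time a queried bond is open. *)
Inductive conn w A : V -> Prop :=
| conn_base x : A x -> conn w A x
| conn_step e x y : conn w A x -> w e -> joins e x y -> conn w A y.

Definition hits w A D : Prop := exists2 z, D z & conn w A z.

Lemma joins_sym e x y : joins e x y -> joins e y x.
Proof. by move=> [[]|[]]; [right|left]. Qed.

Lemma conn_sub w w' A A' x :
  (forall e, w e -> w' e) -> (forall y, A y -> conn w' A' y) ->
  conn w A x -> conn w' A' x.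
Proof.
move=> ww' AA'; elim=> [y /AA'//|e y z _ IH we eyz].
exact: conn_step IH (ww' _ we) eyz.
Qed.

Lemma conn_mono w w' A x : (forall e, w e -> w' e) ->
  conn w A x -> conn w' A x.
Proof. by move=> ww'; apply: conn_sub => // y; exact: conn_base. Qed.

Lemma conn_trans w A B x : (forall y, B y -> conn w A y) -> conn w B x ->
  conn w A x.
Proof. by move=> BA; apply: conn_sub. Qed.

Lemma conn_single w A x : conn w A x -> exists2 a, A a & conn w (eq a) x.
Proof.
elim=> [y Ay|e y z _ [a Aa ay] we eyz]; first by exists y => //; exact: conn_base.
by exists a => //; exact: conn_step ay we eyz.
Qed.

Lemma conn_sym w x y : conn w (eq x) y -> conn w (eq y) x.
Proof.
elim=> [z ->|e y' z _ IH we eyz]; first exact: conn_base.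
apply: (conn_trans (B := eq y')) IH => _ <-.
by apply: (conn_step (e := e) (x := z)) => //; [exact: conn_base|exact: joins_sym].
Qed.

(** Cut a path at its first step out of [B]; up to there it only uses bonds with both ends in
    [B]. *)
Lemma conn_exit w A B x : (forall y, A y -> B y) -> conn w A x -> ~ B x ->
  exists e y z, [/\ B y, ~ B z, joins e y z, w e
    & conn (fun f => w f && (`[< B (src f) >] && `[< B (tgt f) >])) A y].
Proof.
move=> AB; pose w' f := w f && (`[< B (src f) >] && `[< B (tgt f) >]).
suff H : conn w A x -> (B x /\ conn w' A x) \/
  exists e y z, [/\ B y, ~ B z, joins e y z, w e & conn w' A y].
  by move=> /H[[]|].
elim=> [y Ay|e y z _ IH we eyz]; first by left; split; [exact: AB|exact: conn_base].
have [[By wy]|] := IH; last by right.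
have [Bz|Bz] := pselect (B z); last by right; exists e, y, z.
left; split=> //; apply: (conn_step wy _ eyz); rewrite /w' we /=.
by case: eyz => -[-> ->]; apply/andP; split; apply/asboolP.
Qed.

Definition off A w : E -> bool :=
  fun e => w e && ~~ (`[< A (src e) >] || `[< A (tgt e) >]).

(** Cut a path at its last step out of [A]; from there on it uses no bond touching [A]. *)
Lemma conn_last_exit w A x : conn w A x -> ~ A x ->
  exists e y z, [/\ A y, ~ A z, joins e y z, w e & conn (off A w) (eq z) x].
Proof.
elim=> [//|e y z _ IH we eyz] Az.
have [Ay|Ay] := pselect (A y).
  by exists e, y, z; split=> //; exact: conn_base.
have [f [a [b [Aa Ab fab wf by']]]] := IH Ay.
exists f, a, b; split=> //; apply: (conn_step by' _ eyz).
by rewrite /off we /=; apply/norP; case: eyz => -[-> ->]; split; apply/asboolP.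
Qed.

Lemma off_sub A w e : off A w e -> w e.
Proof. by case/andP. Qed.

(** The basic step of every exploration: opening a bond between a source and [u] amounts to making
    [u] a source, after which the state of the bond is irrelevant. *)
Lemma conn_upd_open w A e v u x : joins e v u -> A v ->
  conn (upd w e true) A x <-> conn w (fun y => A y \/ y = u) x.
Proof.
move=> evu Av; split.
  elim=> [y Ay|f y z _ IH]; first by apply: conn_base; left.
  rewrite /upd; have [-> _ eyz|_ wf fyz] := eqVneq f e; last first.
    exact: conn_step IH wf fyz.
  have [|] : z = v \/ z = u.
    by case: eyz => -[s1 t1]; case: evu => -[s2 t2]; [right|left|left|right];
      congruence.
  - by move->; apply: conn_base; left.
  - by move->; apply: conn_base; right.
apply: conn_sub => [f wf|y [Ay|->]].
- by rewrite /upd; case: eqP.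
- exact: conn_base.
- apply: (conn_step (e := e) (x := v)) => //; first exact: conn_base.
  by rewrite upd_same.
Qed.

Lemma hits_mono w w' A A' D D' : (forall e, w e -> w' e) ->
  (forall x, A x -> A' x) -> (forall x, D x -> D' x) ->
  hits w A D -> hits w' A' D'.
Proof.
move=> ww' AA' DD' [z /DD' Dz Az]; exists z => //.
by apply: conn_sub Az => // y /AA'; exact: conn_base.
Qed.

End Connectivity.
Arguments off {V E} src tgt A w _ /.

Definition indic (R : pzRingType) (P : Prop) : R := (`[< P >])%:R.

Section Indic.
Variable R : numDomainType.

Lemma indic_true (P : Prop) : P -> indic R P = 1.
Proof. by move=> HP; rewrite /indic asboolT. Qed.

Lemma indic_false (P : Prop) : ~ P -> indic R P = 0.
Proof. by move=> HP; rewrite /indic asboolF. Qed.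

Lemma indic_ge0 (P : Prop) : 0 <= indic R P.
Proof. exact: ler0n. Qed.

Lemma indic_le1 (P : Prop) : indic R P <= 1.
Proof. by rewrite /indic lern1 leq_b1. Qed.

Lemma indic_le (P Q : Prop) : (P -> Q) -> indic R P <= indic R Q.
Proof.
move=> PQ; have [HP|HP] := pselect P; last by rewrite indic_false ?indic_ge0.
by rewrite !indic_true//; exact: PQ.
Qed.

Lemma indic_eq (P Q : Prop) : (P <-> Q) -> indic R P = indic R Q.
Proof. by move=> PQ; rewrite (propext PQ). Qed.

End Indic.

(* Expectation for independent bonds: those of [l] are open with probability
   [p], all others are closed. *)
Definition perc (R : pzRingType) (E : eqType) (p : R) (l : seq E)
  (f : (E -> bool) -> R) : R := wsum p (1 - p) l f (fun=> false).

Section Perc.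
Variables (R : numDomainType) (E : eqType) (p : R).
Hypotheses (p0 : 0 <= p) (p1 : p <= 1).
Implicit Types (l : seq E) (f g : (E -> bool) -> R).

Let q0 : 0 <= 1 - p. Proof. by rewrite subr_ge0. Qed.
Let pq1 : p + (1 - p) = 1. Proof. by rewrite addrC subrK. Qed.

Lemma ler_perc l f g : (forall v, f v <= g v) -> perc p l f <= perc p l g.
Proof. exact: ler_wsum. Qed.

Lemma eq_perc l f g : f =1 g -> perc p l f = perc p l g.
Proof. exact: eq_wsum. Qed.

Lemma perc_ge0 l f : (forall v, 0 <= f v) -> 0 <= perc p l f.
Proof. exact: wsum_ge0. Qed.

Lemma perc_const l c : perc p l (fun=> c) = c.
Proof. exact: wsum_const. Qed.

Lemma perc_le1 l f : (forall v, f v <= 1) -> perc p l f <= 1.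
Proof. by move=> f1; rewrite -[leRHS](perc_const l); exact: ler_perc. Qed.

Lemma perc_peel l e f : uniq l -> e \in l ->
  perc p l f = p * perc p (rem e l) (fun w => f (upd w e true))
               + (1 - p) * perc p (rem e l) f.
Proof.
move=> ul el; rewrite /perc (wsum_peel _ _ _ _ el); congr (_ * _ + _ * _).
  by rewrite wsum_upd_out// mem_rem_uniqF.
by congr wsum; apply: (@upd_id _ (fun=> false) e).
Qed.

Lemma perm_perc l l' f : perm_eq l l' -> perc p l f = perc p l' f.
Proof. exact: perm_wsum. Qed.

Definition increasing_event (X : (E -> bool) -> Prop) : Prop :=
  forall v w : E -> bool, (forall e, v e -> w e) -> X v -> X w.

(** Whatever states are given to the remaining entries [k] of [l'], an increasing event is at least
    as likely as with these bonds closed. *)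
Lemma perc_subseq l l' (X : (E -> bool) -> Prop) : increasing_event X ->
  uniq l -> {subset l <= l'} ->
  perc p l (fun w => indic R (X w)) <= perc p l' (fun w => indic R (X w)).
Proof.
move=> Xinc ul ll'.
have [k lk] : exists k, perm_eq l' (k ++ l).
  elim: l ul l' ll' => [|x l IH] /= ul l' ll'.
    by exists l'; rewrite cats0.
  have /andP[xl ul'] := ul.
  have xl' : x \in l' by apply: ll'; rewrite mem_head.
  have [|k pk] := IH ul' (rem x l').
    move=> y yl; have /ll' : y \in x :: l by rewrite in_cons yl orbT.
    rewrite (perm_mem (perm_to_rem xl')) in_cons => /orP[/eqP yx|//].
    by move: xl; rewrite -yx yl.
  exists k; apply: perm_trans (perm_to_rem xl') _.
  by rewrite perm_sym -cat1s perm_catCA/= perm_cons perm_sym.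
rewrite (perm_perc _ lk) /perc wsum_cat.
set c := wsum _ _ l _ _.
rewrite -[leLHS](wsum_const pq1 k c (fun=> false)); apply: ler_wsum => // v.
apply: wsum_monotone => // {}v w vw; apply: indic_le; exact: Xinc.
Qed.

End Perc.

(** * Disagreement percolation for the Ising model *)

Section OneEdge.
Variable R : realFieldType.
Implicit Types (b kappa p z n m B : R).

(** Each mixture lies between [p] times the smaller and [p] times the larger of its two values, so
    the weights need not be matched. *)
Lemma mixture_dist p B a1 a2 b1 b2 m1 m2 n1 n2 :
  0 <= a1 -> 0 <= a2 -> a1 + a2 = p -> 0 <= b1 -> 0 <= b2 -> b1 + b2 = p ->
  `|m1 - n1| <= B -> `|m1 - n2| <= B -> `|m2 - n1| <= B -> `|m2 - n2| <= B ->
  `|(a1 * m1 + a2 * m2) - (b1 * n1 + b2 * n2)| <= p * B.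
Proof.
move=> a10 a20 ap b10 b20 bp; rewrite !ler_norml => /andP[? ?] /andP[? ?].
move=> /andP[? ?] /andP[? ?].
have p0 : 0 <= p by rewrite -ap addr_ge0.
have H x1 x2 c1 c2 (u : R) : 0 <= c1 -> 0 <= c2 -> c1 + c2 = p ->
    x1 <= u -> x2 <= u -> c1 * x1 + c2 * x2 <= p * u.
  by move=> ? ? <- ? ?; rewrite mulrDl lerD// ler_wpM2l.
have H' x1 x2 c1 c2 (u : R) : 0 <= c1 -> 0 <= c2 -> c1 + c2 = p ->
    u <= x1 -> u <= x2 -> p * u <= c1 * x1 + c2 * x2.
  by move=> ? ? <- ? ?; rewrite mulrDl lerD// ler_wpM2l.
have mM : a1 * m1 + a2 * m2 <= p * Num.max m1 m2.
  by apply: H => //; rewrite le_max lexx ?orbT.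
have mm : p * Num.min m1 m2 <= a1 * m1 + a2 * m2.
  by apply: H' => //; rewrite ge_min lexx ?orbT.
have nM : b1 * n1 + b2 * n2 <= p * Num.max n1 n2.
  by apply: H => //; rewrite le_max lexx ?orbT.
have nm : p * Num.min n1 n2 <= b1 * n1 + b2 * n2.
  by apply: H' => //; rewrite ge_min lexx ?orbT.
have M1 : Num.max m1 m2 - Num.min n1 n2 <= B.
  by case: (leP m1 m2) => _; case: (leP n1 n2) => _; lra.
have M2 : Num.max n1 n2 - Num.min m1 m2 <= B.
  by case: (leP m1 m2) => _; case: (leP n1 n2) => _; lra.
have := ler_wpM2l p0 M1; have := ler_wpM2l p0 M2.
rewrite !mulrBr => ? ?; apply/andP; split; lra.
Qed.

(* One step of the Edwards-Sokal representation, for a bond between a frozen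
   spin and a free spin [u]: [z1], [z2] are the partition functions with [u] up
   and down in the absence of the bond, [zt] is the one with [u] aligned, and the
   [n]'s are the unnormalised expectations. *)
Lemma tilt_mixture b kappa p z1 z2 zt n1 n2 nt : 0 <= b ->
  b * kappa / (1 + b * kappa) <= p -> p <= 1 -> 0 < z1 -> 0 < z2 ->
  (zt = z1 /\ nt = n1 \/ zt = z2 /\ nt = n2) -> zt <= kappa * (z1 + z2) ->
  exists a1 a2, [/\ 0 <= a1, 0 <= a2, a1 + a2 = p &
    (n1 + n2 + b * nt) / (z1 + z2 + b * zt) =
    (1 - p) * ((n1 + n2) / (z1 + z2)) + (a1 * (n1 / z1) + a2 * (n2 / z2))].
Proof.
move=> b0 bp p1 z10 z20 tE ztk.
have zt0 : 0 < zt by case: tE => -[-> _].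
have s0 : 0 < z1 + z2 by rewrite addr_gt0.
have k0 : 0 < kappa.
  by rewrite -(pmulr_lgt0 _ s0); exact: lt_le_trans ztk.
have t0 : 0 < z1 + z2 + b * zt by rewrite ltr_wpDr// mulr_ge0// ltW.
(* [a] is the Edwards-Sokal probability that the bond is open. To raise it to [p], the missing mass
   [p - a] is taken from the law without the bond, split according to the value of [u]. *)
pose a := b * zt / (z1 + z2 + b * zt).
have a0 : 0 <= a by rewrite divr_ge0 ?mulr_ge0 ?(ltW zt0) ?(ltW t0).
have ap : a <= p.
  apply: le_trans bp; rewrite /a ler_pdivrMr// mulrAC ler_pdivlMr; last first.
    by rewrite ltr_wpDr ?mulr_ge0 ?(ltW k0).
  rewrite -subr_ge0 [leRHS](_ : _ = b * (kappa * (z1 + z2) - zt)); last by ring.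
  by rewrite mulr_ge0// subr_ge0.
have pa z : 0 < z -> 0 <= (p - a) * (z / (z1 + z2)).
  by move=> z0; rewrite mulr_ge0 ?subr_ge0// divr_ge0 ?(ltW z0) ?(ltW s0).
have nz : [/\ z1 != 0, z2 != 0, z1 + z2 != 0 & z1 + z2 + b * zt != 0].
  by split; rewrite gt_eqF.
case: nz => nz1 nz2 nzs nzt.
case: tE => -[zE nE]; subst zt nt.
- exists ((p - a) * (z1 / (z1 + z2)) + a), ((p - a) * (z2 / (z1 + z2))).
  split; [by rewrite addr_ge0// pa|exact: pa| |].
    by rewrite addrAC -mulrDr -mulrDl divff// mulr1 subrK.
  by rewrite /a; field; rewrite nz1 nz2 nzs nzt.
- exists ((p - a) * (z1 / (z1 + z2))), ((p - a) * (z2 / (z1 + z2)) + a).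
  split; [exact: pa|by rewrite addr_ge0// pa| |].
    by rewrite addrA -mulrDr -mulrDl divff// mulr1 subrK.
  by rewrite /a; field; rewrite nz1 nz2 nzs nzt.
Qed.

End OneEdge.

Section Ising.
Variables (R : realType) (V E : eqType) (src tgt : E -> V).
Variables (beta : R) (M : seq V) (k : V -> R).
Implicit Types (G : seq E) (l : seq V) (s : V -> bool) (X : (V -> bool) -> R).

Definition energy G s : R :=
  beta * (\sum_(e <- G) spin R (s (src e)) * spin R (s (tgt e)))
  + \sum_(x <- M) k x * spin R (s x).

Definition partition_fn G l X s : R :=
  wsum 1 1 l (fun s => X s * expR (energy G s)) s.

(* The spins outside of [l] are frozen to their values in [s]. *)
Definition ising G l X s : R :=
  partition_fn G l X s / partition_fn G l (fun=> 1) s.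

Definition incident u e := (src e == u) || (tgt e == u).

Lemma partition_fn_gt0 G l s : 0 < partition_fn G l (fun=> 1) s.
Proof. by apply: wsum_gt0 => // v; rewrite mul1r expR_gt0. Qed.

Lemma ising_itv G l X s : (forall s, 0 <= X s <= 1) -> 0 <= ising G l X s <= 1.
Proof.
move=> X01; apply/andP; split.
  rewrite divr_ge0 ?(ltW (partition_fn_gt0 _ _ _))//.
  by apply: wsum_ge0 => // v; rewrite mulr_ge0 ?expR_ge0//; case/andP: (X01 v).
rewrite ler_pdivrMr ?partition_fn_gt0// mul1r; apply: ler_wsum => // v.
by rewrite ler_wpM2r ?expR_ge0//; case/andP: (X01 v).
Qed.

Lemma energy_flip G s u c c' : 0 <= beta -> uniq M ->
  energy G (upd s u c) <=
  energy G (upd s u c') + 2 * (beta * (count (incident u) G)%:R + `|k u|).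
Proof.
move=> b0 uM; rewrite -lerBlDl /energy opprD addrACA -mulrBr [leRHS]mulrDr.
have spinB (x y : bool) : spin R x - spin R y <= 2 /\ - 2 <= spin R x - spin R y.
  by case: x; case: y; rewrite /spin; split; lra.
apply: lerD.
  rewrite mulrCA ler_wpM2l// -sumrB -sum1_count.
  rewrite natr_sum mulr_sumr [leRHS]big_mkcond/=.
  apply: ler_sum => e _; rewrite /incident /upd.
  case: eqP => _; case: eqP => _ /=; rewrite ?subrr ?mulr1n;
    by rewrite /spin; repeat case: ifP => _; lra.
rewrite -sumrB; have [uM'|uM'] := boolP (u \in M); last first.
  rewrite big_seq big1 ?mulr_ge0// => x xM.
  have /negPf xu : x != u by apply: contra uM' => /eqP <-.
  by rewrite /upd xu subrr.
rewrite (bigD1_seq u)//= big1 ?addr0; last first.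
  by move=> x xu; rewrite /upd (negPf xu) subrr.
rewrite !upd_same -mulrBr mulrC.
apply: le_trans (ler_norm _) _; rewrite normrM ler_wpM2r//.
by rewrite ler_norml; have [-> ->] := spinB c c'.
Qed.

Lemma energy_rem G e s : e \in G -> energy G s =
  beta * (spin R (s (src e)) * spin R (s (tgt e))) + energy (rem e G) s.
Proof.
move=> eG; rewrite /energy (perm_big _ (perm_to_rem eG)) big_cons mulrDr.
by rewrite addrA.
Qed.

End Ising.

Section Disagreement.
Variables (R : realType) (V E : eqType) (src tgt : E -> V).
Variables (beta : R) (M : seq V) (k : V -> R).
Implicit Types (G : seq E) (l : seq V) (s : V -> bool) (X : (V -> bool) -> R).

Local Notation energy := (energy src tgt beta M k).
Local Notation partition_fn := (partition_fn src tgt beta M k).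
Local Notation ising := (ising src tgt beta M k).
Local Notation conn := (conn src tgt).
Local Notation hits := (hits src tgt).
Local Notation joins := (joins src tgt).

Lemma partition_fn_edge G l X s e v u : e \in G -> uniq l -> joins e v u ->
  v \notin l -> u \in l ->
  let n c := partition_fn (rem e G) (rem u l) X (upd s u c) in
  partition_fn G l X s =
  expR (- beta) * (n true + n false + (expR (2 * beta) - 1) * n (s v)).
Proof.
move=> eG ul evu vl ul' n.
have vu : v != u by apply: contraNneq vl => ->.
have nE c : wsum 1 1 (rem u l) (fun t => X t * expR (energy G t)) (upd s u c) =
    expR (- beta) * (1 + (expR (2 * beta) - 1) * (c == s v)%:R) * n c.
  rewrite -wsumZ; apply: eq_wsum_in => t tE.
  have tu : t u = c by rewrite tE ?upd_same// mem_rem_uniqF.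
  have tv : t v = s v.
    rewrite tE; first by rewrite /upd (negPf vu).
    by apply: contra vl; exact: mem_rem.
  rewrite (@energy_rem R V E src tgt beta M k G e t eG) expRD mulrCA; congr (_ * _).
  have -> : spin R (t (src e)) * spin R (t (tgt e)) = spin R c * spin R (s v).
    by case: evu => -[-> ->]; rewrite tu tv// mulrC.
  have -> : expR (2 * beta) = expR beta / expR (- beta).
    by rewrite -expRN opprK -expRD; congr expR; ring.
  have := expR_gt0 (- beta) => /gt_eqF/negbT e0.
  have -> : spin R c * spin R (s v) = if c == s v then 1 else - 1.
    by rewrite /spin; case: c {tE tu}; case: (s v) {tv};
      rewrite /= ?mulr1 ?mul1r ?mulrNN ?mulr1.
  by case: (c == s v); rewrite ?mulrN !mulr1 ?mulr0 ?addr0//; field.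
rewrite /partition_fn (wsum_peel _ _ _ _ ul') !mul1r !nE.
by case: (s v); rewrite /= !mulr0 !mulr1 !addr0; ring.
Qed.

Variables (X : (V -> bool) -> R) (D : V -> Prop) (K p : R).
Hypotheses (beta0 : 0 <= beta) (uM : uniq M) (X01 : forall s, 0 <= X s <= 1).
Hypothesis XD : depends_on D X.
Hypotheses (p1 : p <= 1).
(** The largest probability that finite energy allows for a prescribed spin value, when a flip
    changes the weight by a factor of at most [expR (2 * K)]. *)
Let kappa := (1 + expR (- (2 * K)))^-1.
Let b := expR (2 * beta) - 1.
Hypothesis pK : b * kappa / (1 + b * kappa) <= p.

(** When no bond joins [Dis] to a free spin, couple the two systems by giving the free spins the
    same values. Terms touching [Dis] then involve frozen spins only and the other terms coincide,
    so the energies differ by a constant that cancels in the quotient. *)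
Lemma ising_eq_separated G l (Dis : V -> Prop) s s' :
  (forall x, Dis x -> x \notin l) -> (forall x, ~ Dis x -> s x = s' x) ->
  (forall x, Dis x -> ~ D x) ->
  (forall e v u, e \in G -> joins e v u -> Dis v -> u \notin l) ->
  ising G l X s = ising G l X s'.
Proof.
move=> Disl ss' DisD sep.
pose c := expR (energy G s' - energy G s).
have H (Y : (V -> bool) -> R) : depends_on D Y ->
    partition_fn G l Y s' = c * partition_fn G l Y s.
  move=> YD; rewrite /partition_fn -wsumZ; apply: (@eq_wsum_rel _ _ _ _
    (fun t' t => [/\ forall x, ~ Dis x -> t x = t' x,
      forall x, x \notin l -> t x = s x & forall x, x \notin l -> t' x = s' x])).
  - move=> t' t x d xl [tt' ts ts']; split=> y Hy; rewrite /upd.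
    + by case: eqP => // _; exact: tt'.
    + by have [yx|_] := eqVneq y x; [move: Hy; rewrite yx xl|exact: ts].
    + by have [yx|_] := eqVneq y x; [move: Hy; rewrite yx xl|exact: ts'].
  - move=> t' t [tt' ts ts']; rewrite mulrCA.
    rewrite (YD t' t); last by move=> x Dx; rewrite tt'// => /DisD.
    rewrite -expRD; congr (_ * expR _).
    have FE : energy G t' - energy G t = energy G s' - energy G s.
      rewrite /energy.
      have split4 (x1 y1 x2 y2 : R) :
          beta * x1 + y1 - (beta * x2 + y2) = beta * (x1 - x2) + (y1 - y2).
        by ring.
      rewrite !split4 -!sumrB.
      congr (_ * _ + _).
        rewrite !big_seq; apply: eq_bigr => e eG.
        have [De|De] := pselect (Dis (src e) \/ Dis (tgt e)).
          have [srcl tgtl] : src e \notin l /\ tgt e \notin l.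
            case: De => De; split; first [exact: Disl
              |by apply: (sep e _ _ eG _ De); first [by left|by right]].
          by rewrite !ts ?ts'.
        have [Ds Dt] : ~ Dis (src e) /\ ~ Dis (tgt e) by split=> ?; apply: De; tauto.
        by rewrite !tt' ?ss' ?subrr.
      apply: eq_bigr => x _; have [Dx|Dx] := pselect (Dis x).
        by rewrite ts ?ts' ?Disl.
      by rewrite tt' ?ss' ?subrr.
    by lra.
  - by [].
by rewrite /ising !H// -mulf_div divff ?mul1r// gt_eqF// expR_gt0.
Qed.

(** Flipping [u] pointwise compares the partition functions for its two values up to the factor
    [expR (2 * K)], which bounds the share of either one. *)
Lemma finite_energy G l s u t :
  beta * (count (incident src tgt u) G)%:R + `|k u| <= K -> u \notin l ->
  partition_fn G l (fun=> 1) (upd s u t) <=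
  kappa * (partition_fn G l (fun=> 1) (upd s u true) +
           partition_fn G l (fun=> 1) (upd s u false)).
Proof.
move=> HK ul; pose z c := partition_fn G l (fun=> 1) (upd s u c).
rewrite -!/(z _).
have zz c c' : z c <= expR (2 * K) * z c'.
  rewrite /z /partition_fn !wsum_upd_out// -wsumZ; apply: ler_wsum => // v.
  rewrite !mul1r -expRD ler_expR addrC.
  apply: (le_trans (energy_flip src tgt k G v u c c' beta0 uM)).
  by rewrite lerD2l ler_wpM2l.
have e0 := expR_gt0 (2 * K).
rewrite /kappa mulrC ler_pdivlMr ?ltr_wpDr ?expR_ge0// expRN mulrDr mulr1.
have zt : z t / expR (2 * K) <= z (~~ t) by rewrite ler_pdivrMr// mulrC.
by case: t zt => /= zt; lra.
Qed.

(* The bonds at the set [Dis] of possible disagreements are explored one at a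
   time. A bond from [Dis] to a free spin [u] only matters if it is open in the
   Edwards-Sokal representation; as [u] is misaligned with probability at least
   [1 - kappa] by finite energy, this has probability at most [p], whatever has
   been explored before. Without bonds left, the two free systems coincide. *)
Lemma disagreement_percolation G l (Dis : V -> Prop) s s' :
  (forall u, beta * (count (incident src tgt u) G)%:R + `|k u| <= K) ->
  uniq G -> uniq l ->
  (forall x, Dis x -> x \notin l) -> (forall x, ~ Dis x -> s x = s' x) ->
  `|ising G l X s - ising G l X s'| <=
  perc p G (fun w => indic R (hits w Dis D)).
Proof.
have b0 : 0 <= b by rewrite subr_ge0 -expR0 ler_expR mulr_ge0.
have p0 : 0 <= p.
  apply: le_trans pK; have ? : 0 <= kappa by rewrite invr_ge0 addr_ge0 ?expR_ge0.
  by rewrite divr_ge0 ?addr_ge0 ?mulr_ge0.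
(* Once the disagreement set meets [D] the percolation bound equals 1 and nothing is left to
   prove. *)
have touch G' l' (Dis' : V -> Prop) t t' : (exists x, D x /\ Dis' x) ->
    `|ising G' l' X t - ising G' l' X t'| <=
    perc p G' (fun w => indic R (hits w Dis' D)).
  move=> [x [Dx Disx]].
  have -> : perc p G' (fun w => indic R (hits w Dis' D)) = 1.
    rewrite -[RHS](perc_const p G' 1); apply: eq_wsum => w; apply: indic_true.
    by exists x => //; exact: conn_base.
  have /andP[? ?] := ising_itv src tgt beta M k G' l' t X01.
  have /andP[? ?] := ising_itv src tgt beta M k G' l' t' X01.
  by rewrite ler_norml; apply/andP; split; lra.
move: {2}(size G) (erefl (size G)) => N.
elim: N G l Dis s s' => [|N IH] G l Dis s s' GN HK uG ul Disl ss'.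
all: have [/touch//|DisD] := pselect (exists x, D x /\ Dis x).
  rewrite (ising_eq_separated Disl ss') ?subrr ?normr0.
  - by apply: perc_ge0 => // w; exact: indic_ge0.
  - by move=> x ? ?; apply: DisD; exists x.
  - by move=> e v u; rewrite (size0nil GN).
have [[e [v [u [eG evu Disv ul']]]]|sep] :=
  pselect (exists e v u, [/\ e \in G, joins e v u, Dis v & u \in l]); last first.
  rewrite (ising_eq_separated Disl ss') ?subrr ?normr0.
  - by apply: perc_ge0 => // w; exact: indic_ge0.
  - by move=> x ? ?; apply: DisD; exists x.
  - by move=> e v u eG evu Dv; apply/negP => ul'; apply: sep; exists e, v, u.
have vl := Disl _ Disv.
set G' := rem e G; set l' := rem u l.
have uG' : uniq G' by exact: rem_uniq.
have ul'' : uniq l' by exact: rem_uniq.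
have NG' : size G' = N by rewrite size_rem// GN.
have HK' x : beta * (count (incident src tgt x) G')%:R + `|k x| <= K.
  apply: le_trans (HK x); rewrite lerD2r ler_wpM2l// ler_nat.
  rewrite (permP (perm_to_rem eG) (incident src tgt x)) /=.
  exact: leq_addl.
have peelG (Y : (V -> bool) -> R) t : ising G l Y t =
  let n c := partition_fn G' l' Y (upd t u c) in
  let z c := partition_fn G' l' (fun=> 1) (upd t u c) in
  (n true + n false + b * n (t v)) / (z true + z false + b * z (t v)).
  rewrite /ising !(partition_fn_edge _ _ eG ul evu vl ul') -mulf_div divff ?mul1r//.
  by rewrite gt_eqF// expR_gt0.
have peelG' (Y : (V -> bool) -> R) t : ising G' l Y t =
  let n c := partition_fn G' l' Y (upd t u c) in
  let z c := partition_fn G' l' (fun=> 1) (upd t u c) in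
  (n true + n false) / (z true + z false).
  by rewrite /ising /partition_fn !(wsum_peel _ _ _ _ ul') !mul1r.
have mix t : exists a1 a2, [/\ 0 <= a1, 0 <= a2, a1 + a2 = p &
    ising G l X t = (1 - p) * ising G' l X t +
      (a1 * ising G' l' X (upd t u true) + a2 * ising G' l' X (upd t u false))].
  rewrite peelG peelG' /=; apply: (tilt_mixture b0 pK p1).
  - exact: partition_fn_gt0.
  - exact: partition_fn_gt0.
  - by case: (t v); [left|right].
  - by apply: finite_energy => //; rewrite mem_rem_uniqF.
have [a1 [a2 [a10 a20 ap ->]]] := mix s.
have [b1 [b2 [b10 b20 bp ->]]] := mix s'.
rewrite (perc_peel _ _ uG eG) [leRHS]addrC -/G'.
set A := perc p G' _; set B := perc p G' _.
have regroup (x y z t : R) : x + y - (z + t) = (x - z) + (y - t) by ring.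
rewrite regroup.
apply: le_trans (ler_normD _ _) _; apply: lerD.
  rewrite -mulrBr normrM ger0_norm ?subr_ge0// ler_wpM2l ?subr_ge0//.
  exact: (IH G' l Dis).
(* If the bond is open, [u] is frozen to values that may differ between the two systems; it joins
   the disagreement set, just as it joins the sources once the bond is opened in the percolation. *)
have HB c c' : `|ising G' l' X (upd s u c) - ising G' l' X (upd s' u c')| <= B.
  have -> : B = perc p G' (fun w => indic R (hits w (fun y => Dis y \/ y = u) D)).
    apply: eq_wsum => w; apply: indic_eq.
    by split=> -[z Dz /(conn_upd_open _ _ evu Disv) zc]; exists z.
  apply: IH => // x.
  - move=> [Dx|->]; last by rewrite mem_rem_uniqF.
    by apply: contra (Disl _ Dx); exact: mem_rem.
  - move=> Dx; rewrite /upd; have [xu|_] := eqVneq x u.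
      by case: Dx; right.
    by apply: ss' => Dx'; apply: Dx; left.
exact: mixture_dist.
Qed.

End Disagreement.

(** * Simon-Lieb inequality and sharpness *)

Section FiniteCriterion.
Variables (R : realType) (V E : eqType) (src tgt : E -> V).
Implicit Types (w : E -> bool) (A B D S : V -> Prop) (e : E) (l r G : seq E).

Local Notation conn := (conn src tgt).
Local Notation hits := (hits src tgt).
Local Notation joins := (joins src tgt).
Local Notation off := (off src tgt).

Definition inside S e := S (src e) /\ S (tgt e).
Definition crosses S e := (S (src e) /\ ~ S (tgt e)) \/ (~ S (src e) /\ S (tgt e)).
Definition inner S e : V := if `[< S (src e) >] then src e else tgt e.
Definition outer S e : V := if `[< S (src e) >] then tgt e else src e.

Definition enumerates (P : E -> Prop) l := uniq l /\ forall e, e \in l <-> P e.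

(* Duminil-Copin and Tassion's [phi_p(S)] is [p * exit_sum p S o li lb] when
   [li] lists the bonds inside [S] and [lb] those of its edge boundary. *)
Definition exit_sum (p : R) S (o : V) (li lb : seq E) : R :=
  \sum_(e <- lb) perc p li (fun w => indic R (conn w (eq o) (inner S e))).

Lemma crosses_joins S e : crosses S e ->
  [/\ joins e (inner S e) (outer S e), S (inner S e) & ~ S (outer S e)].
Proof.
rewrite /inner /outer => -[[Ss St]|[Ss St]].
  by rewrite asboolT//; split=> //; left.
by rewrite asboolF//; split=> //; right.
Qed.

Lemma joins_crosses S e y z : joins e y z -> S y -> ~ S z ->
  [/\ crosses S e, inner S e = y & outer S e = z].
Proof.
move=> eyz Sy Sz; rewrite /inner /outer /crosses.
by case: eyz => -[-> ->]; [rewrite asboolT//|rewrite asboolF//]; split=> //; tauto.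
Qed.

Section SimonLieb.
Variables (p m : R) (S D : V -> Prop) (lb : seq E).
Hypotheses (p0 : 0 <= p) (p1 : p <= 1) (m0 : 0 <= m).
Hypothesis SD : forall x, S x -> ~ D x.
Hypothesis lbP : enumerates (crosses S) lb.
Hypothesis outer_le : forall G e, uniq G -> e \in lb ->
  perc p G (fun w => indic R (hits w (eq (outer S e)) D)) <= m.

Let q0 : 0 <= 1 - p. Proof. by rewrite subr_ge0. Qed.

(** End of the exploration: [B] is closed under the bonds of [l]. A path from [B] to [D] last leaves
    [B] through an open bond of the edge boundary of [S], which costs [p]; its continuation avoids
    [B], hence is independent of that bond, and costs at most [m]. *)
Lemma simon_lieb_separated l r B : uniq (l ++ r) ->
  (forall x, B x -> S x) -> (forall e, e \in r -> ~ inside S e) ->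
  (forall e v u, e \in l -> joins e v u -> B v -> B u) ->
  perc p (l ++ r) (fun w => indic R (hits w B D)) <=
  p * m * \sum_(e <- lb) perc p l (fun w => indic R (conn w B (inner S e))).
Proof.
move=> ulr BS rS sep; have [ulb lbE] := lbP.
pose g e w : R := indic R (B (inner S e) /\ w e) *
  indic R (hits (off B w) (eq (outer S e)) D).
apply: (@le_trans _ _ (perc p (l ++ r) (fun w => \sum_(e <- lb) g e w))).
  apply: ler_wsum_in => // w wlr.
  have g0 e : 0 <= g e w by rewrite mulr_ge0// indic_ge0.
  have [[x Dx Bx]|h] := pselect (hits w B D); last first.
    by rewrite indic_false//; apply: sumr_ge0.
  have Bx' : ~ B x by move=> /BS /SD.
  have [e [y [z [By Bz eyz we zx]]]] := conn_last_exit Bx Bx'.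
  have er : e \in r.
    have : e \in l ++ r by apply: contraT => /wlr; rewrite we.
    by rewrite mem_cat => /orP[el|//]; case: Bz; apply: sep el eyz By.
  have Sz : ~ S z.
    by move=> Sz; apply: (rS _ er); rewrite /inside; case: eyz => -[-> ->];
      split=> //; exact: BS.
  have [ec ei eo] := joins_crosses eyz (BS _ By) Sz.
  rewrite indic_true; last by exists x.
  rewrite (big_rem e)/=; last exact/lbE.
  have -> : g e w = 1.
    by rewrite /g ei eo !indic_true ?mulr1//; exists x.
  by rewrite lerDl sumr_ge0.
rewrite /perc wsum_sum mulr_sumr big_seq [leRHS]big_seq.
apply: ler_sum => e elb.
(* [B] is not random: either the summand vanishes, or the inner end lies in [B] and its connection
   to [B] is certain. *)
have [Be|Be] := pselect (B (inner S e)); last first.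
  rewrite (eq_wsum _ _ _ (g := fun=> 0)) ?[wsum _ _ _ _ _]perc_const//; last first.
    by move=> w; rewrite /g indic_false ?mul0r// => -[].
  by rewrite !mulr_ge0//; apply: wsum_ge0 => // v; exact: indic_ge0.
rewrite -!/(perc _ _ _) (_ : perc p l _ = 1) ?mulr1; last first.
  rewrite -[RHS](perc_const p l 1); apply: eq_wsum => w.
  by rewrite indic_true//; exact: conn_base.
have [elr|elr] := boolP (e \in l ++ r); last first.
  rewrite [leLHS](_ : _ = 0) ?mulr_ge0// -(perc_const p (l ++ r) 0).
  apply: eq_wsum_in => w wlr; rewrite /g indic_false ?mul0r// => -[_].
  by rewrite wlr.
rewrite (perc_peel _ _ ulr elr) [X in _ + _ * X](_ : _ = 0); last first.
  rewrite -(perc_const p (rem e (l ++ r)) 0); apply: eq_wsum_in => w wlr.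
  by rewrite /g indic_false ?mul0r// => -[_]; rewrite wlr// mem_rem_uniqF.
rewrite mulr0 addr0 ler_wpM2l//.
apply: (le_trans _ (outer_le (rem_uniq _ ulr) elb)).
apply: ler_perc => // w.
have [ej Si So] := crosses_joins ((lbE e).1 elb).
rewrite /g indic_true ?mul1r; last by split=> //; rewrite upd_same.
(* The continuation uses no bond touching [B], in particular not [e], so forcing [e] open does not
   affect it. *)
apply: indic_le; apply: hits_mono => // f /andP[].
rewrite /upd; case: eqP => // -> _ /norP[Bs Bt]; exfalso.
by case: ej => -[se te]; [case/asboolP: Bs; rewrite se|case/asboolP: Bt; rewrite te].
Qed.

(** Explore the cluster of [B] inside [S]. Conditioning on a bond of [l] that leads out of [B]
    splits both sides in the same way, which reduces the claim to the end of the exploration. *)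
Lemma simon_lieb_explore l r B : uniq (l ++ r) ->
  (forall x, B x -> S x) -> (forall e, e \in l -> inside S e) ->
  (forall e, e \in r -> ~ inside S e) ->
  perc p (l ++ r) (fun w => indic R (hits w B D)) <=
  p * m * \sum_(e <- lb) perc p l (fun w => indic R (conn w B (inner S e))).
Proof.
move: {2}(size l) (erefl (size l)) => N.
elim: N l B => [|N IH] l B lN ulr BS lS rS.
  by apply: simon_lieb_separated => // e v u; rewrite (size0nil lN).
have [[e [v [u [el evu Bv Bu]]]]|sep] :=
  pselect (exists e v u, [/\ e \in l, joins e v u, B v & ~ B u]); last first.
  apply: simon_lieb_separated => // e v u el evu Bv.
  by apply: contrapT => Bu; apply: sep; exists e, v, u.
have [ul er] : uniq l /\ e \notin r.
  move: ulr; rewrite cat_uniq => /and3P[-> /hasPn H _]; split=> //.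
  by apply/negP => /H; rewrite el.
have elr : e \in l ++ r by rewrite mem_cat el.
have remE : rem e (l ++ r) = rem e l ++ r.
  rewrite !rem_filter// filter_cat; congr (_ ++ _); apply/all_filterP/allP => f fr.
  by apply: contraNneq er => <-.
rewrite (perc_peel _ _ ulr elr) remE.
under [X in _ <= _ * X]eq_bigr => f _ do rewrite (perc_peel _ _ ul el).
rewrite big_split/= -!mulr_sumr mulrDr !(mulrCA (p * m)).
have u' : uniq (rem e l ++ r) by rewrite -remE rem_uniq.
have lS' f : f \in rem e l -> inside S f by move=> /mem_rem/lS.
have lN' : size (rem e l) = N by rewrite size_rem// lN.
apply: lerD; rewrite ler_wpM2l//; last exact: IH.
have Bu' x : B x \/ x = u -> S x.
  move=> [/BS//|->]; have := lS _ el; rewrite /inside.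
  by case: evu => -[-> ->] [].
have := IH _ (fun x => B x \/ x = u) lN' u' Bu' lS' rS.
rewrite (eq_perc _ _ (g := fun w => indic R (hits (upd w e true) B D))); last first.
  move=> w; apply: indic_eq.
  by split=> -[z Dz /(conn_upd_open _ _ evu Bv) zc]; exists z.
move=> /le_trans; apply; rewrite ler_wpM2l ?mulr_ge0//.
apply: ler_sum => f _; apply: ler_perc => // w; apply: indic_le.
by move/(conn_upd_open _ _ evu Bv).
Qed.

Lemma simon_lieb G li o : uniq G -> S o -> enumerates (inside S) li ->
  perc p G (fun w => indic R (hits w (eq o) D)) <= p * exit_sum p S o li lb * m.
Proof.
move=> uG So [uli liE]; pose a e := `[< inside S e >].
have G_split : perm_eq G ([seq e <- G | a e] ++ [seq e <- G | predC a e]).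
  by rewrite perm_sym; apply/permPl; exact: perm_filterC.
rewrite (perm_perc _ _ G_split).
apply: (le_trans (simon_lieb_explore (B := eq o) _ _ _ _)).
- by rewrite -(perm_uniq G_split).
- by move=> x <-.
- by move=> e; rewrite mem_filter => /andP[/asboolP].
- by move=> e; rewrite mem_filter => /andP[/asboolPn].
rewrite mulrAC ler_wpM2r// ler_wpM2l//; apply: ler_sum => e _.
(* The bonds of [G] inside [S] are only some of those listed in [li], and connection is an
   increasing event. *)
apply: perc_subseq => //; last 2 first.
- by rewrite filter_uniq.
- by move=> f; rewrite mem_filter => /andP[/asboolP /liE].
by move=> v w vw; exact: conn_mono.
Qed.

End SimonLieb.

End FiniteCriterion.

(** * Russo's formula and the differential inequality *)

Section Russo.
Variables (R : realType) (E : eqType).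
Implicit Types (l : seq E) (f : (E -> bool) -> R) (w : E -> bool).

(** Russo's formula for an arbitrary observable: the product rule at the first bond yields the term
    for that bond, and induction yields the others. *)
Lemma is_derive_wsum l f w (q : R) : uniq l ->
  is_derive q 1 (fun t : R => wsum t (1 - t) l f w)
    (\sum_(e <- l) wsum q (1 - q) l
       (fun v => f (upd v e true) - f (upd v e false)) w).
Proof.
elim: l w => [w _|e l IH w /= /andP[el ul]].
  by rewrite big_nil; exact: is_derive_cst.
have dT := IH (upd w e true) ul; have dF := IH (upd w e false) ul.
have dq := is_deriveB (is_derive_cst (1 : R) q 1) (is_derive_id q (1 : R)).
apply: (is_derive_eq (is_deriveD (is_deriveM (is_derive_id q (1 : R)) dT)
  (is_deriveM dq dF))).
rewrite big_cons big_split/= -!mulr_sumr !wsum_upd_out// /GRing.scale/=.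
rewrite !fctE.
have uT : (fun v => f (upd (upd v e true) e true) - f (upd (upd v e true) e false))
    = (fun v => f (upd v e true) - f (upd v e false)).
  by apply: funext => v; rewrite !upd_upd.
have uF : (fun v => f (upd (upd v e false) e true) - f (upd (upd v e false) e false))
    = (fun v => f (upd v e true) - f (upd v e false)).
  by apply: funext => v; rewrite !upd_upd.
by rewrite uT uF wsumB; ring.
Qed.

End Russo.

Section Sharpness.
Variables (R : realType) (V E : eqType) (src tgt : E -> V) (o : V).
Implicit Types (w : E -> bool) (A S : V -> Prop) (e : E) (l K : seq E).

Local Notation conn := (conn src tgt).
Local Notation joins := (joins src tgt).
Local Notation off := (off src tgt).
Local Notation inside := (inside src tgt).
Local Notation crosses := (crosses src tgt).
Local Notation inner := (inner src tgt).
Local Notation exit_sum := (exit_sum src tgt).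

(** When [A] is not connected to [o], these bonds are pivotal: they lead from the cluster of [A] to
    a vertex joined to [o] off that cluster. *)
Definition cut w A e : Prop := crosses (fun x => ~ conn w A x) e /\
  conn (off (conn w A) w) (eq o) (inner (fun x => ~ conn w A x) e).

(** Quantified over all supersets of [A] because it is applied to the complement of the cluster of
    [A], which is random. *)
Definition all_exit_sums_ge1 (q : R) A := forall A' li lb,
  (forall x, A x -> A' x) -> ~ A' o ->
  enumerates (inside (fun x => ~ A' x)) li ->
  enumerates (crosses (fun x => ~ A' x)) lb ->
  1 <= exit_sum q (fun x => ~ A' x) o li lb.

Section FixedParameter.
Variable q : R.
Hypotheses (q0 : 0 <= q) (q1 : q <= 1).

(** State of an exploration: [l] lists the unexplored bonds and [K] those found closed, which may
    still be cuts. Bonds found open are dropped, as both their ends lie in the cluster. *)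
Definition expected_cuts A l K : R :=
  perc q l (fun w =>
    indic R (~ conn w A o) * \sum_(e <- K ++ l) indic R (cut w A e)).

Lemma off_conn_upd w A v u e b : joins e v u -> conn w A v ->
  off (conn w A) (upd w e b) = off (conn w A) w.
Proof.
move=> evu Av; apply: funext => f; rewrite /= /upd; case: eqP => // ->.
have : `[< conn w A (src e) >] || `[< conn w A (tgt e) >].
  by apply/orP; case: evu => -[-> ->]; [left|right]; apply/asboolP.
by move=> ->; rewrite !andbF.
Qed.

Lemma expected_cuts_ge0 A l K : 0 <= expected_cuts A l K.
Proof.
by apply: perc_ge0 => // w; rewrite mulr_ge0 ?sumr_ge0 ?indic_ge0// => e _;
  exact: indic_ge0.
Qed.

(** End of the exploration: the cluster of [A] is [A] itself, the bonds inside its complement are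
    still unexplored, and the expected number of cuts is at least an exit sum of that complement. *)
Lemma expected_cuts_separated A l K : all_exit_sums_ge1 q A -> uniq (K ++ l) ->
  (forall e, ~ inside A e -> e \in K ++ l) ->
  (forall e, inside (fun x => ~ A x) e -> e \in l) ->
  (forall e v u, e \in l -> joins e v u -> A v -> A u) ->
  perc q l (fun w => 1 - indic R (conn w A o)) <= expected_cuts A l K.
Proof.
move=> exits uKl Kl inl sep.
have [Ao|Ao] := pselect (A o).
  rewrite (eq_perc _ _ (g := fun=> 0)) ?perc_const ?expected_cuts_ge0// => w.
  by rewrite indic_true ?subrr//; exact: conn_base.
have ul : uniq l by move: uKl; rewrite cat_uniq => /and3P[].
have connA w : (forall e, e \notin l -> w e = false) -> conn w A = A.
  move=> wl; apply: funext => x; apply: propext; split; last exact: conn_base.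
  elim=> // e y z _ Ay we eyz; apply: sep eyz Ay.
  by apply: contraT => /wl; rewrite we.
pose S x := ~ A x; pose a e := `[< inside S e >]; pose c e := `[< crosses S e >].
set li := [seq e <- l | a e]; set lb := [seq e <- K ++ l | c e].
have liE : enumerates (inside S) li.
  split; first by rewrite filter_uniq.
  move=> e; rewrite mem_filter; split; first by case/andP => /asboolP.
  by move=> ie; apply/andP; split; [exact/asboolP|exact: inl].
have lbE : enumerates (crosses S) lb.
  split; first by rewrite filter_uniq.
  move=> e; rewrite mem_filter; split; first by case/andP => /asboolP.
  move=> ce; apply/andP; split; [exact/asboolP|apply: Kl => -[]].
  by case: ce => -[]; rewrite /S; tauto.
apply: (@le_trans _ _ 1).
  by apply: perc_le1 => // w; rewrite gerBl indic_ge0.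
apply: le_trans (exits A li lb _ Ao liE lbE) _ => //.
rewrite /expected_cuts.
rewrite [leRHS](_ : _ = perc q l (fun w => \sum_(e <- lb)
    indic R (conn (off A w) (eq o) (inner S e)))); last first.
  apply: eq_wsum_in => w wl; rewrite connA// indic_true// mul1r.
  rewrite big_filter [RHS]big_mkcond; apply: eq_bigr => e _.
  rewrite /cut connA// -/S /c; case: asboolP => ce.
    by apply: indic_eq; tauto.
  by rewrite indic_false// => -[].
rewrite /perc wsum_sum; apply: ler_sum => e _.
(* Separate the bonds inside [S] from the rest; the connection off [A] does not depend on the
   latter, which integrate out. *)
have -> : wsum q (1 - q) l (fun w => indic R (conn (off A w) (eq o) (inner S e)))
    (fun=> false) =
    perc q ([seq f <- l | a f] ++ [seq f <- l | predC a f])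
      (fun w => indic R (conn (off A w) (eq o) (inner S e))).
  by apply: perm_wsum; rewrite perm_sym; exact: (permEl (perm_filterC a l)).
rewrite /perc wsum_cat; apply: ler_wsum_in; rewrite ?subr_ge0// => w wli.
rewrite (@wsum_out _ _ _ _ _ _ (inside S)); first last.
- by move=> f; rewrite mem_filter => /andP[/asboolPn].
- move=> v v' vv'; apply: indic_eq; rewrite (_ : off A v = off A v')//.
  apply: funext => f; rewrite /=.
  have [Af|Af] := boolP (`[< A (src f) >] || `[< A (tgt f) >]).
    by rewrite !andbF.
  rewrite vv'//; move/norP: Af => [/asboolPn ? /asboolPn ?].
  by split.
- by rewrite addrC subrK.
apply: indic_le; apply: conn_mono => f wf /=; rewrite wf /=.
have : f \in li by apply: contraT => /wli; rewrite wf.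
rewrite mem_filter => /andP[/asboolP[? ?] _].
by apply/norP; split; apply/asboolPn.
Qed.

(* Exploring the cluster of [A] leaves the bonds outside of the cluster
   independent, so that on the event that it does not contain [o] the expected
   number of pivotal bonds given the cluster is an exit sum of its
   complement. *)
Lemma expected_cuts_ge A l K : all_exit_sums_ge1 q A -> uniq (K ++ l) ->
  (forall e, ~ inside A e -> e \in K ++ l) ->
  (forall e, inside (fun x => ~ A x) e -> e \in l) ->
  perc q l (fun w => 1 - indic R (conn w A o)) <= expected_cuts A l K.
Proof.
move: {2}(size l) (erefl (size l)) => N.
elim: N A l K => [|N IH] A l K lN exits uKl Kl inl.
  by apply: expected_cuts_separated => // e v u; rewrite (size0nil lN).
have [[e [v [u [el evu Av Au]]]]|sep] :=
  pselect (exists e v u, [/\ e \in l, joins e v u, A v & ~ A u]); last first.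
  apply: expected_cuts_separated => // e v u el evu Av.
  by apply: contrapT => Au; apply: sep; exists e, v, u.
have ul : uniq l by move: uKl; rewrite cat_uniq => /and3P[].
have lN' : size (rem e l) = N by rewrite size_rem// lN.
have eK : e \notin K.
  by move: uKl; rewrite cat_uniq => /and3P[_ /hasPn/(_ _ el)].
have perm1 : perm_eq (K ++ l) (e :: K ++ rem e l).
  by rewrite perm_sym -cat1s perm_catCA perm_cat2l perm_sym perm_to_rem.
have u1 : uniq (e :: K ++ rem e l) by rewrite -(perm_uniq perm1).
have connU w : conn (upd w e true) A = conn w (fun x => A x \/ x = u).
  by apply: funext => x; apply: propext; exact: (conn_upd_open _ _ evu Av).
rewrite /expected_cuts !(perc_peel _ _ ul el).
apply: lerD; rewrite ler_wpM2l ?subr_ge0//; last first.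
  apply: le_trans (IH A (rem e l) (e :: K) lN' exits u1 _ _) _.
  - by move=> f /Kl; rewrite (perm_mem perm1).
  - move=> f fin; have := inl _ fin; rewrite (perm_mem (perm_to_rem el)) in_cons.
    by case/predU1P => // fe; case: fin; rewrite fe; case: evu => -[-> ->].
  apply: ler_perc => // w; rewrite ler_wpM2l ?indic_ge0//.
  by rewrite (perm_big _ perm1).
rewrite (eq_perc _ _ (g := fun w => 1 - indic R (conn w (fun x => A x \/ x = u) o)));
  last by move=> w; rewrite connU.
apply: le_trans (IH (fun x => A x \/ x = u) (rem e l) K lN' _ _ _ _) _.
- by move=> A' li lb AA'; apply: exits => x Ax; apply: AA'; left.
- by case/andP: u1.
- move=> f fin; have : f \in K ++ l by apply: Kl => -[? ?]; apply: fin; split; left.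
  rewrite (perm_mem perm1) in_cons => /predU1P[fe|//]; exfalso; apply: fin.
  by rewrite fe /inside; case: evu => -[-> ->]; split; tauto.
- move=> f [fs ft]; have : f \in l by apply: inl; split; tauto.
  rewrite (perm_mem (perm_to_rem el)) in_cons.
  case/predU1P => // fe; exfalso.
  by move: fs ft; rewrite fe; case: evu => -[-> ->]; tauto.
apply: ler_perc => // w; rewrite connU ler_wpM2l ?indic_ge0//.
rewrite (perm_big _ perm1)/= big_cons ler_wpDl ?indic_ge0//.
apply: ler_sum => f _; rewrite /cut connU (off_conn_upd _ evu)//.
by apply: conn_base; left.
Qed.

Lemma cut_pivotal w A e : cut w A e -> ~ conn w A o ->
  conn (upd w e true) A o /\ ~ conn (upd w e false) A o.
Proof.
move=> [/crosses_joins[ej Cin Cout] Co] nAo; split; last first.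
  move=> Ao; apply: nAo; apply: conn_mono Ao => f; rewrite /upd.
  by case: eqP.
have up f : w f -> upd w e true f by rewrite /upd; case: eqP.
have {Cout} Ay := contrapT Cout.
apply: (conn_trans (B := eq (inner (fun x => ~ conn w A x) e))); last first.
  by apply: conn_sym; apply: conn_mono Co => f /off_sub/up.
move=> _ <-; apply: (conn_step (e := e)); last exact: joins_sym ej.
  exact: conn_mono Ay.
exact: upd_same.
Qed.

(** Start the exploration with nothing revealed. Every cut is pivotal, so the derivative given by
    Russo's formula dominates the expected number of cuts. *)
Lemma russo_ge A l : all_exit_sums_ge1 q A -> uniq l ->
  (forall e, ~ inside A e -> e \in l) ->
  1 - perc q l (fun w => indic R (conn w A o)) <=
  \sum_(e <- l) perc q l (fun w =>
     indic R (conn (upd w e true) A o) - indic R (conn (upd w e false) A o)).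
Proof.
move=> exits ul Al.
have := expected_cuts_ge (K := [::]) exits ul Al.
rewrite {1}/perc wsumB [X in X - _]perc_const => /(_ _)/le_trans; apply.
  by move=> e [? ?]; apply: Al => -[].
rewrite /expected_cuts /perc -wsum_sum; apply: ler_wsum; rewrite ?subr_ge0// => w.
rewrite mulr_sumr cat0s; apply: ler_sum => e _.
have [Ao|Ao] := pselect (conn w A o).
  rewrite indic_false ?mul0r; last by move/(_ Ao).
  rewrite subr_ge0; apply: indic_le; apply: conn_mono => f.
  by rewrite /upd; case: eqP.
rewrite indic_true// mul1r.
have [ce|ce] := pselect (cut w A e); last first.
  rewrite indic_false// subr_ge0; apply: indic_le; apply: conn_mono => f.
  by rewrite /upd; case: eqP.
have [oT oF] := cut_pivotal ce Ao.
by rewrite (indic_true _ ce) (indic_true _ oT) (indic_false _ oF) subr0.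
Qed.

End FixedParameter.

(** The differential inequality [theta' >= 1 - theta] makes [(1 - theta q) * expR q] nonincreasing
    between [p] and [p'], by the mean value theorem. *)
Lemma sharpness A l (p p' : R) : 0 <= p -> p < p' -> p' <= 1 -> uniq l ->
  (forall e, ~ inside A e -> e \in l) ->
  (forall q, p < q -> q < p' -> all_exit_sums_ge1 q A) ->
  1 - expR (p - p') <= perc p' l (fun w => indic R (conn w A o)).
Proof.
move=> p0 pp' p'1 ul Al exits.
pose theta q : R := perc q l (fun w => indic R (conn w A o)).
pose dtheta q : R := \sum_(e <- l) perc q l (fun w =>
     indic R (conn (upd w e true) A o) - indic R (conn (upd w e false) A o)).
pose F (q : R) : R := (1 - theta q) * expR q.
pose dF (q : R) : R := (1 - theta q) * expR q - expR q * dtheta q.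
have dFP (q : R) : is_derive q (1 : R) F (dF q).
  have dt : is_derive q (1 : R) theta (dtheta q) by exact: is_derive_wsum.
  apply: (is_derive_eq (is_deriveM
    (is_deriveB (is_derive_cst (1 : R) q 1) dt) (is_derive_expR q))).
  by rewrite /dF /GRing.scale/= !fctE; ring.
have [|c cI Fc] := @MVT R F dF p p' pp' (fun q _ => dFP q).
  by apply: derivable_within_continuous => q _; apply: ex_derive.
move: cI; rewrite in_itv/= => /andP[pc cp'].
have dFc : dF c <= 0.
  rewrite /dF mulrC -mulrBr pmulr_rle0 ?expR_gt0// subr_le0.
  by apply: russo_ge (exits _ pc cp') ul Al; lra.
have : F p' <= F p.
  by rewrite -subr_le0 Fc mulr_le0_ge0// subr_ge0 ltW.
rewrite /F => H; have th0 : 0 <= theta p.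
  by apply: perc_ge0 => [||w]; rewrite ?indic_ge0//; lra.
have : (1 - theta p') * expR p' <= expR p.
  by apply: le_trans H _; rewrite ler_piMl ?expR_ge0//; lra.
rewrite -ler_pdivlMr ?expR_gt0// -expRN -expRD; rewrite /theta; lra.
Qed.

End Sharpness.

(** * Percolation on the cubic lattice *)

Lemma perc_map (R : pzRingType) (E : eqType) (p : R) (T T' : E -> E) l f :
  cancel T T' -> cancel T' T ->
  perc p [seq T e | e <- l] f = perc p l (fun w => f (fun e => w (T' e))).
Proof.
move=> TK T'K; rewrite /perc.
suff H w : wsum p (1 - p) [seq T e | e <- l] f (fun e => w (T' e)) =
    wsum p (1 - p) l (fun w => f (fun e => w (T' e))) w by exact: H.
elim: l w => //= x l IH w.
have uT b : upd (fun e => w (T' e)) (T x) b = (fun e => upd w x b (T' e)).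
  apply: funext => e; rewrite /upd.
  by have [->|ex] := eqVneq e (T x); rewrite ?TK ?eqxx// (can2_eq T'K TK) (negPf ex).
by rewrite !uT !IH.
Qed.

(** An inequality only, since [I] may repeat bonds or contain bonds outside [G]. *)
Lemma perc_all_closed_ge (R : numDomainType) (E : eqType) (p : R) (I G : seq E) :
  0 <= p -> p <= 1 -> uniq G ->
  (1 - p) ^+ size I <= perc p G (fun w => indic R (forall e, e \in I -> ~~ w e)).
Proof.
move=> p0 p1; have q0 : 0 <= 1 - p by rewrite subr_ge0.
elim: I G => [|e I IH] G uG.
  rewrite expr0 (eq_perc _ _ (g := fun=> 1)) ?perc_const// => w.
  by rewrite indic_true.
have f0 w : 0 <= indic R (forall e', e' \in e :: I -> ~~ w e') by exact: indic_ge0.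
have step H : uniq H -> e \notin H ->
    perc p H (fun w => indic R (forall e, e \in I -> ~~ w e)) =
    perc p H (fun w => indic R (forall e', e' \in e :: I -> ~~ w e')).
  move=> uH eH; apply: eq_wsum_in => w wH; apply: indic_eq; split=> h f.
    by rewrite in_cons => /orP[/eqP ->|/h//]; rewrite wH.
  by move=> fI; apply: h; rewrite in_cons fI orbT.
have [eG|eG] := boolP (e \in G); last first.
  rewrite -step// exprS; apply: le_trans (IH _ uG).
  by rewrite ler_piMl ?exprn_ge0// gerBl.
rewrite (perc_peel _ _ uG eG) exprS ler_wpDl ?mulr_ge0 ?perc_ge0//.
rewrite ler_wpM2l// -step ?rem_uniq ?mem_rem_uniqF//.
by apply: IH; exact: rem_uniq.
Qed.

Section Lattice.
Variables (R : realType) (d : nat).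
Implicit Types (x y z : site d) (e : bond d) (G : seq (bond d)).

Definition bond_src e : site d := e.1.
Definition bond_tgt e : site d := e.1 + unit_vec e.2.

Local Notation conn := (conn bond_src bond_tgt).
Local Notation hits := (hits bond_src bond_tgt).
Local Notation joins := (joins bond_src bond_tgt).
Local Notation inside := (inside bond_src bond_tgt).
Local Notation crosses := (crosses bond_src bond_tgt).
Local Notation inner := (inner bond_src bond_tgt).
Local Notation outer := (outer bond_src bond_tgt).
Local Notation exit_sum := (exit_sum bond_src bond_tgt).

(** The l1 distance: it changes by at most one along a bond and dominates the Euclidean distance. *)
Definition dist1 x y : nat := (\sum_(i < d) `|(x 0 i - y 0 i)%R|)%N.

Lemma dist1_triangle y x z : (dist1 x z <= dist1 x y + dist1 y z)%N.
Proof.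
rewrite /dist1 -big_split/=; apply: leq_sum => i _.
rewrite -lez_nat PoszD !abszE.
by rewrite (le_trans _ (ler_normD _ _))// addrA subrK.
Qed.

Lemma dist1C x y : dist1 x y = dist1 y x.
Proof. by apply: eq_bigr => i _; rewrite -abszN opprB. Qed.

Lemma dist1_shift z x y : dist1 (x + z) (y + z) = dist1 x y.
Proof. by apply: eq_bigr => i _; rewrite !mxE opprD addrACA subrr addr0. Qed.

Lemma dist1_unit x i : dist1 x (x + unit_vec i) = 1%N.
Proof.
rewrite /dist1 (bigD1 i)//= big1 ?addn0 => [|j ji].
  by rewrite !mxE !eqxx opprD addrA subrr sub0r.
by rewrite !mxE (negPf ji) andbF addr0 subrr.
Qed.

Lemma dist1_joins e x y : joins e x y -> dist1 x y = 1%N.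
Proof.
by case=> -[<- <-]; rewrite /bond_src /bond_tgt ?[dist1 (_ + _) _]dist1C dist1_unit.
Qed.

Lemma eucl_dist_le_dist1 x y : eucl_dist R x y <= (dist1 x y)%:R.
Proof.
rewrite /eucl_dist -[leRHS]ger0_norm// -sqrtr_sqr ler_wsqrtr// /dist1 natr_sum.
have absE (z : int) : (`|z|%N)%:R = `|z%:~R| :> R by rewrite natr_absz intr_norm.
(* The induction also carries the nonnegativity of the partial sum, needed for the cross term of the
   square. *)
suff [] : \sum_(i < d) ((x 0 i - y 0 i)%:~R ^+ 2) <=
    (\sum_(i < d) `|(x 0 i - y 0 i)%R|%N%:R) ^+ 2 :> R /\
    0 <= \sum_(i < d) `|(x 0 i - y 0 i)%R|%N%:R :> R by [].
elim/big_rec2 : _ => [|i s t _ [ts s0]]; first by rewrite expr0n.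
split; last by rewrite addr_ge0.
rewrite sqrrD absE real_normK ?num_real// -addrA lerD2l ler_wpDl//.
by rewrite mulrn_wge0// mulr_ge0.
Qed.

Definition shift z e : bond d := (e.1 + z, e.2).

Lemma shiftK z : cancel (shift z) (shift (- z)).
Proof. by case=> x i; rewrite /shift/= addrK. Qed.

Lemma shiftNK z : cancel (shift (- z)) (shift z).
Proof. by case=> x i; rewrite /shift/= subrK. Qed.

Lemma bond_tgt_shift z e : bond_tgt (shift z e) = bond_tgt e + z.
Proof. by rewrite /bond_tgt /= addrAC. Qed.

Lemma joins_shift z e x y : joins e x y -> joins (shift z e) (x + z) (y + z).
Proof.
rewrite /joins !bond_tgt_shift.
by case=> -[<- <-]; [left|right].
Qed.

Lemma conn_shift z w x y : conn w (eq x) y ->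
  conn (fun e => w (shift (- z) e)) (eq (x + z)) (y + z).
Proof.
elim=> [_ <-|e a b _ IH we eab]; first exact: conn_base.
by apply: (conn_step (e := shift z e) IH); [rewrite shiftK|exact: joins_shift].
Qed.

Section Decay.
Variables (p phi : R) (S : site d -> Prop) (rho : nat) (li lb : seq (bond d)).
Hypotheses (p0 : 0 <= p) (p1 : p <= 1) (S0 : S 0).
Hypothesis S_rho : forall x, S x -> (dist1 0%R x <= rho)%N.
Hypotheses (liP : enumerates (inside S) li) (lbP : enumerates (crosses S) lb).
Hypothesis S_phi : p * exit_sum p S 0 li lb <= phi.

Let phi0 : 0 <= phi.
Proof.
apply: le_trans S_phi; rewrite mulr_ge0// sumr_ge0// => e _.
by apply: perc_ge0 => // w; exact: indic_ge0.
Qed.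

Let Sat y := fun x => S (x - y).

Lemma enumerates_shift (P Q : bond d -> Prop) l y : enumerates P l ->
  (forall e, Q (shift y e) <-> P e) -> enumerates Q (map (shift y) l).
Proof.
move=> [ul lP] PQ; split; first by rewrite map_inj_uniq//; exact: can_inj (shiftK y).
move=> e; rewrite -{2}(shiftNK y e) PQ -lP.
by rewrite -{1}(shiftNK y e) mem_map//; exact: can_inj (shiftK y).
Qed.

Lemma exit_sum_shift y :
  exit_sum p (Sat y) y (map (shift y) li) (map (shift y) lb) =
  exit_sum p S 0 li lb.
Proof.
rewrite /exit_sum big_map; apply: eq_bigr => e _.
rewrite (perc_map _ _ _ (shiftK y) (shiftNK y)); apply: eq_perc => w.
have -> : inner (Sat y) (shift y e) = inner S e + y.
  rewrite /inner bond_tgt_shift /Sat /bond_src /= addrK.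
  by case: ifP.
apply: indic_eq; split; last first.
  by move/(conn_shift y); rewrite add0r.
move/(conn_shift (- y)); rewrite subrr addrK opprK.
by rewrite (_ : (fun e => _) = w)//; apply: funext => f; rewrite shiftK.
Qed.

(** Each Simon-Lieb step with the translate of [S] to [y] gains a factor [phi] and restarts from a
    vertex at distance at most [rho + 1], whence the distance [k * rho.+1] for [k] factors. *)
Lemma exponential_decay k y D G : uniq G ->
  (forall z, D z -> (k * rho.+1 < dist1 y z)%N) ->
  perc p G (fun w => indic R (hits w (eq y) D)) <= phi ^+ k.
Proof.
elim: k y G => [|k IH] y G uG Dk.
  by rewrite expr0; apply: perc_le1 => // w; exact: indic_le1.
have Sy_rho x : Sat y x -> (dist1 y x <= rho)%N.
  by move=> /S_rho; rewrite -(dist1_shift y) add0r subrK.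
have inE (e : bond d) : inside (Sat y) (shift y e) <-> inside S e.
  by rewrite /inside bond_tgt_shift /Sat /bond_src/= !addrK.
have crE (e : bond d) : crosses (Sat y) (shift y e) <-> crosses S e.
  by rewrite /crosses bond_tgt_shift /Sat /bond_src/= !addrK.
have liP' := enumerates_shift liP inE.
have lbP' := enumerates_shift lbP crE.
apply: (@le_trans _ _ (p * exit_sum p (Sat y) y (map (shift y) li) (map (shift y) lb)
   * phi ^+ k)); last first.
  by rewrite exit_sum_shift exprS ler_wpM2r// exprn_ge0.
apply: simon_lieb => //; rewrite ?exprn_ge0//.
- move=> x /Sy_rho xr /Dk; rewrite mulSn => /leq_trans /(_ xr).
  by rewrite ltnNge (leq_trans (leqnSn rho))// leq_addr.
- move=> G' e uG' /(lbP'.2 e)/crosses_joins[ej Si So].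
  apply: IH => // z /Dk; rewrite mulSn => Dz.
  have := dist1_triangle (outer (Sat y) e) y z.
  move=> /(leq_trans Dz); rewrite -ltnS.
  have : (dist1 y (outer (Sat y) e) <= rho.+1)%N.
    apply: leq_trans (dist1_triangle (inner (Sat y) e) _ _) _.
    by rewrite (dist1_joins ej) addn1 ltnS Sy_rho.
  by lia.
- by rewrite /Sat subrr.
Qed.

End Decay.

Definition star x : seq (bond d) :=
  [seq (x, i) | i <- ord_enum d] ++ [seq (x - unit_vec i, i) | i <- ord_enum d].

Lemma size_star x : size (star x) = d.*2.
Proof.
by rewrite size_cat !size_map -(size_map val) val_ord_enum size_iota addnn.
Qed.

Lemma mem_star x e : (e \in star x) = (bond_src e == x) || (bond_tgt e == x).
Proof.
case: e => z i; rewrite mem_cat /bond_src /bond_tgt /=; congr (_ || _).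
  apply/mapP/eqP => [[j _ [-> _]//]|->]; exists i => //; exact: mem_ord_enum.
apply/mapP/eqP => [[j _ [-> ->]]|<-]; first by rewrite subrK.
by exists i; rewrite ?mem_ord_enum// addrK.
Qed.

Lemma uniq_star x : uniq (star x).
Proof.
rewrite cat_uniq !map_inj_uniq ?ord_enum_uniq//=; first last.
- by move=> i j [].
- by move=> i j [].
rewrite andbT; apply/hasPn => _ /mapP[i _ ->]; apply/mapP => -[j _ []].
move=> /eqP; rewrite -subr_eq0 addrAC subrr sub0r oppr_eq0 => /eqP/rowP/(_ i).
by rewrite !mxE !eqxx.
Qed.

Lemma incident_star x e : incident bond_src bond_tgt x e = (e \in star x).
Proof. by rewrite mem_star. Qed.

Lemma count_incident_le x G : uniq G ->
  (count (incident bond_src bond_tgt x) G <= d.*2)%N.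
Proof.
move=> uG; rewrite -size_filter -(size_star x) uniq_leq_size ?filter_uniq// => e.
by rewrite mem_filter incident_star => /andP[].
Qed.

(** Closing the bonds at [y] isolates it. This bound serves at distances too short for a Simon-Lieb
    step. *)
Lemma two_point_le (p : R) x y G : 0 <= p -> p <= 1 -> uniq G -> x <> y ->
  perc p G (fun w => indic R (hits w (eq y) (eq x))) <= 1 - (1 - p) ^+ d.*2.
Proof.
move=> p0 p1 uG xy; rewrite lerBrDl.
have := perc_all_closed_ge (star y) p0 p1 uG; rewrite size_star => closed.
rewrite -[leRHS](perc_const p G 1).
apply: le_trans (lerD closed (lexx _)) _.
rewrite /perc -wsumD; apply: ler_wsum; rewrite ?subr_ge0// => w.
have [yx|yx] := pselect (hits w (eq y) (eq x)); last first.
  by rewrite (indic_false _ yx) addr0 indic_le1.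
rewrite [X in X + _]indic_false ?add0r ?indic_le1// => closed'.
have [_ <- yx'] := yx.
have [|e [_ [z [<- yz eyz we _]]]] := conn_last_exit yx'; first by move=> /esym.
suff /closed' : e \in star y by rewrite we.
by rewrite mem_star; case: eyz => -[-> ->]; rewrite eqxx ?orbT.
Qed.

End Lattice.

Section CriticalPoint.
Variables (R : realType) (d : nat).
Implicit Types (x y z : site d) (e : bond d) (w : bond_config d).

Local Notation bsrc := (@bond_src d).
Local Notation btgt := (@bond_tgt d).
Local Notation conn := (conn bsrc btgt).
Local Notation joins := (joins bsrc btgt).
Local Notation inside := (inside bsrc btgt).
Local Notation crosses := (crosses bsrc btgt).
Local Notation exit_sum := (exit_sum bsrc btgt).

(** The Duminil-Copin and Tassion criterion; the radius [rho] expresses that [S] is finite. *)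
Definition finite_size_criterion (p : R) : Prop :=
  exists (S : site d -> Prop) (rho : nat) (li lb : seq (bond d)),
  [/\ S 0, forall x, S x -> (dist1 0%R x <= rho)%N,
      enumerates (inside S) li, enumerates (crosses S) lb
    & p * exit_sum p S 0 li lb < 1].

Lemma finite_size_criterion_small (p : R) : 0 <= p -> p <= 1 ->
  p * (d.*2)%:R < 1 -> finite_size_criterion p.
Proof.
move=> p0 p1 pd; exists (eq 0), 0%N, [::], (star 0); split=> //.
- by move=> x <-; rewrite /dist1 big1// => i _; rewrite subrr.
- split=> // e; split=> // -[/esym e0].
  rewrite /bond_tgt -/(bsrc e) e0 add0r => /rowP/(_ e.2).
  by rewrite !mxE !eqxx.
- split; first exact: uniq_star.
  move=> e; rewrite mem_star; split.
    have st : bsrc e = 0 -> btgt e = 0 -> False.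
      rewrite /bond_tgt -/(bsrc e) => -> /rowP/(_ e.2).
      by rewrite !mxE !eqxx.
    by move=> /orP[]/eqP e0; [left|right]; split=> //; try exact/esym;
      move=> /esym e0'; apply: st.
  by case=> -[]; [move=> <- _|move=> _ <-]; rewrite eqxx ?orbT.
- apply: le_lt_trans pd; rewrite ler_wpM2l//.
  rewrite -(size_star (0 : site d)) -sum1_size natr_sum; apply: ler_sum => e _.
  by apply: perc_le1 => // w; exact: indic_le1.
Qed.

Lemma conn_open_cluster w x y : open_cluster w x y <-> conn w (eq x) y.
Proof.
have stepE a b : open_step w a b <-> exists2 e, w e & joins e a b.
  split.
    move=> /existsP[i /orP[]/andP[/eqP -> we]].
      by exists (a, i) => //; left.
    by exists (b, i) => //; right.
  move=> [[z i] we [[<- <-]|[<- <-]]]; apply/existsP; exists i; apply/orP.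
    by left; rewrite eqxx.
  by right; rewrite eqxx.
split.
  move=> [s xs ->]; elim: s x xs => [|a s IH] x /=.
    by move=> _; exact: conn_base.
  move=> /andP[/stepE[e we ea] /IH h]; apply: conn_trans h => _ <-.
  by apply: conn_step we ea; exact: conn_base.
elim=> [_ <-|e a b _ [s xs aE] we eab]; first by exists [::].
exists (rcons s b); last by rewrite last_rcons.
by rewrite rcons_path xs -aE; apply/stepE; exists e.
Qed.

Definition outside_box n : site d -> Prop := fun z => z \notin box d n.

Definition box_bonds n : seq (bond d) :=
  undup (flatten [seq star x | x <- box d n]).

Lemma mem_box_bonds n e :
  reflect (~ inside (outside_box n) e) (e \in box_bonds n).
Proof.
rewrite mem_undup; apply: (iffP flatten_mapP).
  move=> [x xb]; rewrite mem_star => ex -[so to_].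
  by case/orP: ex => /eqP ex; [move/negP: so|move/negP: to_]; rewrite ex.
move=> nin; have [sb|sb] := boolP (bsrc e \in box d n).
  by exists (bsrc e) => //; rewrite mem_star eqxx.
have [tb|tb] := boolP (btgt e \in box d n).
  by exists (btgt e) => //; rewrite mem_star eqxx orbT.
by case: nin.
Qed.

Definition leaves_box n w : Prop := exists2 z, outside_box n z & conn w (eq 0) z.

(** Stopping a path at its first exit shows that only bonds touching the box matter, so the event
    depends on finitely many bonds. *)
Lemma leaves_boxE n w : leaves_box n w <->
  conn (fun e => w e && (e \in box_bonds n)) (outside_box n) 0.
Proof.
split=> [[z zn z0]|/conn_single[a an a0]]; last first.
  by exists a => //; apply: conn_sym; apply: conn_mono a0 => e /andP[].
have [|e [a [b [an bn eab we h]]]] :=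
  conn_exit (B := fun x => x \in box d n) _ z0 (elimN idP zn).
  by move=> _ <-; exact: origin_box.
have up f : w f && (`[< bsrc f \in box d n >] && `[< btgt f \in box d n >]) ->
    w f && (f \in box_bonds n).
  by move=> /andP[-> /andP[/asboolP sb _]]; apply/mem_box_bonds => -[/negP].
have {}h := conn_mono up h.
apply: (conn_trans (B := eq b)) => [_ <-|]; first by apply: conn_base; apply/negP.
apply: conn_sym; apply: (conn_step (e := e) h) => //; rewrite we /=.
by apply/mem_box_bonds => -[] /negP; case: eab => -[-> ->] // _ /negP.
Qed.

Lemma box_mono m n : (m <= n)%N -> {subset box d m <= box d n}.
Proof.
move=> mn x; rewrite !in_box => /forallP xm; apply/forallP => i.
by apply: le_trans (xm i) _; rewrite lez_nat.
Qed.

Lemma box_dist1 n x : x \in box d n -> (dist1 0%R x <= d * n)%N.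
Proof.
rewrite in_box => /forallP xn; rewrite /dist1 -[d in (d * n)%N]card_ord.
rewrite -sum_nat_const; apply: leq_sum => i _.
by rewrite mxE sub0r abszN -lez_nat abszE.
Qed.

Lemma dist1_box n x : (dist1 0%R x <= n)%N -> x \in box d n.
Proof.
move=> xn; rewrite in_box; apply/forallP => i; rewrite -abszE lez_nat.
apply: leq_trans xn; rewrite /dist1 (bigD1 i)//= mxE sub0r abszN.
exact: leq_addr.
Qed.

Lemma percolates_leaves w : origin_percolates w <-> forall n, leaves_box n w.
Proof.
split.
  move=> inf n; apply: contrapT => nl; apply: inf.
  apply: (@sub_finite_set _ _ [set` box d n]); last exact: finite_fset.
  move=> z /conn_open_cluster z0 /=; apply: contrapT => zn; apply: nl.
  by exists z => //; apply/negP.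
move=> lv /finite_fsetP[X XE].
have [n Xn] : exists n, forall x, x \in X -> x \in box d n.
  exists (\max_(x <- X) dist1 0%R x)%N => x xX.
  by apply: dist1_box; exact: leq_bigmax_seq.
have [z /negP zn /conn_open_cluster] := lv n.
by rewrite XE => /Xn.
Qed.

End CriticalPoint.

(** * Percolation measures on the infinite lattice *)

Section BernoulliPercolation.
Variables (R : realType) (d : nat) (p : R) (P : probability (bond_space d) R).
Hypothesis P_product : bernoulli_product p P.
Implicit Types (e : bond d) (w : bond_config d) (F : {fset bond d}).

Local Open Scope classical_set_scope.

Lemma bond_event_measurable e b :
  measurable ([set w | w e = b] : set (bond_space d)).
Proof.
have open_e : measurable ([set w | w e] : set (bond_space d)).
  by apply: sub_sigma_algebra; exists e.
case: b => //; rewrite (_ : [set _ | _] = ~` [set w : bond_space d | w e]).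
  exact: measurableC.
by apply/seteqP; split=> w /=; [move=> ->|move/negP/negbTE].
Qed.

Lemma cylinder_measurable F w0 :
  measurable ([set w | forall e, e \in F -> w e = w0 e] : set (bond_space d)).
Proof.
rewrite (_ : [set _ | _] =
    \big[setI/setT]_(e <- F) [set w : bond_space d | w e = w0 e]).
  by apply: bigsetI_measurable => e _; exact: bond_event_measurable.
rewrite -bigcap_seq; apply/seteqP; split=> w /= Fw e; exact: Fw.
Qed.

(** Split according to the state of one bond of [l] at a time and move it into the cylinder base
    [F]; without bonds left the event is a cylinder or empty. *)
Lemma product_probability (l : seq (bond d)) F w0 (X : bond_config d -> Prop) :
  uniq l -> (forall e, e \in l -> e \notin F) ->
  depends_on (fun e => e \in F \/ e \in l) X ->
  let A : set (bond_space d) :=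
    [set w | (forall e, e \in F -> w e = w0 e) /\ X w] in
  measurable A /\
  P A = (\prod_(e <- F) (if w0 e then p else 1 - p) *
         wsum p (1 - p) l (fun w => indic R (X w)) w0)%:E.
Proof.
elim: l F w0 => [|e l IH] F w0 /= ul lF dX.
  have [Xw0|Xw0] := pselect (X w0).
    rewrite (_ : [set _ | _] = [set w | forall e, e \in F -> w e = w0 e]).
      rewrite indic_true// mulr1; split; first exact: cylinder_measurable.
      exact: P_product.
    apply/seteqP; split=> w; first by case.
    move=> Fw; split=> //; rewrite (dX w w0)// => e [|//].
    exact: Fw.
  rewrite (_ : [set _ | _] = set0).
    by rewrite indic_false// mulr0 measure0; split.
  apply/seteqP; split=> // w [Fw Xw]; apply: Xw0.
  by rewrite -(dX w w0)// => e [|//]; exact: Fw.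
have /andP[el ul'] := ul.
have eF : e \notin F by apply: lF; rewrite mem_head.
pose A b : set (bond_space d) := [set w |
  (forall f, f \in (e |` F)%fset -> w f = upd w0 e b f) /\ X w].
have IHb b : measurable (A b) /\
  P (A b) = ((if b then p else 1 - p) *
    (\prod_(f <- F) (if w0 f then p else 1 - p) *
     wsum p (1 - p) l (fun w => indic R (X w)) (upd w0 e b)))%:E.
  have [||mA ->] := IH (e |` F)%fset (upd w0 e b) ul'.
  - move=> f fl; rewrite in_fset1U negb_or lF ?in_cons ?fl ?orbT// andbT.
    by apply: contraNneq el => <-.
  - move=> v w vw; apply: dX => f [fF|fl]; apply: vw.
      by left; rewrite in_fset1U fF orbT.
    move: fl; rewrite in_cons => /orP[/eqP ->|]; last by right.
    by left; rewrite in_fset1U eqxx.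
  split=> //; rewrite big_fsetU1//= upd_same mulrA.
  congr ((_ * _ * _)%:E); apply: eq_big_seq => f fF; rewrite /upd.
  by have [fe|//] := eqVneq f e; move: eF; rewrite -fe fF.
have [mT PT] := IHb true; have [mF PF] := IHb false.
rewrite (_ : [set _ | _] = A true `|` A false); last first.
  apply/seteqP; split=> w /=.
    move=> [Fw Xw]; have Aw : A (w e) w.
      split=> // f; rewrite in_fset1U /upd; have [->//|_ /= fF] := eqVneq f e.
      exact: Fw.
    by case: (w e) Aw; [left|right].
  by move=> [] [Fw Xw]; split=> // f fF;
    rewrite Fw ?in_fset1U ?fF ?orbT// /upd; have [fe|//] := eqVneq f e;
    move: eF; rewrite -fe fF.
split; first exact: measurableU.
have -> : P (A true `|` A false) = (P (A true) + P (A false))%E.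
  apply: measureU => //; apply/seteqP; split=> // w [[Tw _] [Fw _]].
  have eU : e \in (e |` F)%fset by rewrite in_fset1U eqxx.
  by have := Tw _ eU; rewrite Fw// !upd_same.
by rewrite PT PF -EFinD; congr (_%:E); ring.
Qed.

Lemma finite_event_probability (l : seq (bond d)) (X : bond_config d -> Prop) :
  uniq l -> depends_on (fun e => e \in l) X ->
  measurable ([set w | X w] : set (bond_space d)) /\
  P [set w | X w] = (perc p l (fun w => indic R (X w)))%:E.
Proof.
move=> ul dX; have [|||mX PX] := @product_probability l fset0 (fun=> false) X.
- by [].
- by move=> e _; rewrite in_fset0.
- by move=> v w vw; apply: dX => e el; apply: vw; right.
have XE : [set w | (forall e, e \in fset0 -> w e = false) /\ X w] =
    [set w | X w] :> set (bond_space d).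
  by apply/seteqP; split=> w; [case|split=> // e; rewrite in_fset0].
by move: mX PX; rewrite XE big_nil mul1r.
Qed.

Lemma leaves_box_probability n :
  measurable ([set w | leaves_box n w] : set (bond_space d)) /\
  P [set w | leaves_box n w] = (perc p (box_bonds d n) (fun w =>
    indic R (conn (@bond_src d) (@bond_tgt d) w (outside_box n) 0)))%:E.
Proof.
pose X w := conn (@bond_src d) (@bond_tgt d)
  (fun e => w e && (e \in box_bonds d n)) (outside_box n) 0.
have XE : [set w | leaves_box n w] = [set w | X w] :> set (bond_space d).
  by apply/seteqP; split=> w /leaves_boxE.
have [||mX PX] := @finite_event_probability (box_bonds d n) X.
- exact: undup_uniq.
- move=> v w vw; rewrite /X.
  rewrite (_ : (fun e => v e && _) = fun e => w e && (e \in box_bonds d n))//.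
  apply: funext => e; have [el|] := boolP (e \in _); last by rewrite !andbF.
  by rewrite vw.
rewrite XE PX; split=> //; congr (_%:E); apply: eq_wsum_in => w wl.
rewrite /X (_ : (fun e => w e && _) = w)//; apply: funext => e.
by have [|/wl ->//] := boolP (e \in _); rewrite andbT.
Qed.

Lemma leaves_box_cvg : P (@origin_percolates d) = 0%E ->
  (fun n => P [set w | leaves_box n w]) @ \oo --> 0%E.
Proof.
move=> P0; pose F n : set (bond_space d) := [set w | leaves_box n w].
have FE : \bigcap_n F n = @origin_percolates d.
  apply/seteqP; split=> w /=.
    by move=> Fw; apply/percolates_leaves => n; exact: Fw.
  by move=> /percolates_leaves Fw n _; exact: Fw.
rewrite -P0 -FE; apply: nonincreasing_cvg_mu.
- by rewrite (le_lt_trans (probability_le1 _ _))// ?ltry//;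
    case: (leaves_box_probability 0).
- by move=> n; case: (leaves_box_probability n).
- by apply: bigcap_measurable => // n _; case: (leaves_box_probability n).
- move=> m n mn; apply/subsetPset => w [z zn wz]; exists z => //.
  by apply: contra zn; exact: box_mono.
Qed.

End BernoulliPercolation.

Section BelowCriticality.
Variables (R : realType) (d : nat).

(** Choose a non-percolating [p'] above [p]. If the criterion failed throughout the interval between
    them, sharpness would bound the probability of leaving every box at [p'] away from 0. *)
Lemma finite_size_criterion_subcritical (p : R) : 0 <= p -> p < p_c R d ->
  exists q, [/\ p <= q, q < 1 & finite_size_criterion d q].
Proof.
move=> p0; rewrite /p_c; set U := [set p | _]%classic => pU.
have [|U0] := pselect (U !=set0)%classic; last first.
  (* The supremum of the empty set is 0 by default, which contradicts [0 <= p < p_c]. *)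
  have UE : U = set0 by apply/seteqP; split=> // x Ux; apply: U0; exists x.
  by move: pU; rewrite UE sup0 => /lt_geF; rewrite p0.
move=> /sup_gt/(_ pU)[p' [/andP[p'0 p'1] [P PP P0]] pp'].
apply: contrapT => nq.
suff H n : ((1 - expR (p - p'))%:E <= P [set w | leaves_box n w]%classic)%E.
  have : ((1 - expR (p - p'))%:E <= 0)%E.
    by apply: cvge_ge (leaves_box_cvg PP P0); exact: nearW.
  rewrite lee_fin subr_le0 -expR0 ler_expR subr_ge0 => /le_lt_trans/(_ pp').
  by rewrite ltxx.
rewrite (leaves_box_probability PP n).2 lee_fin.
apply: sharpness => //; first exact: undup_uniq.
- by move=> e /mem_box_bonds.
move=> q pq qp' A li lb nA A0 liP lbP; rewrite leNgt; apply/negP => exit1.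
apply: nq; exists q; split; [exact: ltW|exact: lt_le_trans p'1|].
exists (fun x => ~ A x), (d * n)%N, li, lb; split=> //.
  move=> x Ax; apply: box_dist1; apply: contrapT => xn; apply: Ax.
  by apply: nA; apply/negP.
have q0 : 0 <= q by exact: le_trans (ltW pq).
have q1 : q <= 1 by apply: ltW; exact: lt_le_trans p'1.
(* Pivotality does not ask the exit bond to be open, so the exit sum in the sharpness argument lacks
   the factor [q <= 1] of the criterion. *)
apply: le_lt_trans exit1; rewrite ler_piMl// sumr_ge0// => e _.
by apply: perc_ge0 => // w; exact: indic_ge0.
Qed.

End BelowCriticality.

Lemma two_point_decay (R : realType) (d : nat) (q : R) : 0 <= q -> q < 1 ->
  finite_size_criterion d q ->
  exists2 C : R, 0 < C & forall (G : seq (bond d)) (x y : site d), uniq G ->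
    perc q G (fun w => indic R (hits (@bond_src d) (@bond_tgt d) w (eq y) (eq x)))
    <= expR (- C * eucl_dist R x y).
Proof.
move=> q0 q1 [S [rho [li [lb [S0 S_rho liP lbP]]]]].
set phi := q * _ => phi1; have q1' := ltW q1.
have phi0 : 0 <= phi.
  rewrite mulr_ge0// sumr_ge0// => e _.
  by apply: perc_ge0 => // w; exact: indic_ge0.
pose t : R := 1 - (1 - q) ^+ d.*2.
(* [phi] serves at long distances and [t] at short ones; the entry 1/2 keeps [r] positive, so that
   [ln r] is meaningful. *)
pose r := Num.max (Num.max phi t) 2^-1.
have r0 : 0 < r by rewrite lt_max invr_gt0 ltr0n orbT.
have r1 : r < 1.
  rewrite !gt_max phi1 gtrBl exprn_gt0 ?subr_gt0//=.
  by rewrite invf_lt1 ?ltr0n// ltr1n.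
(* With this rate [m] factors [r] cover the distance [2 * rho.+1 * m]; the factor 2 absorbs the
   rounding in [k] below. *)
have C0 : 0 < - ln r / (2 * rho.+1)%:R.
  by rewrite divr_gt0 ?ltr0n// oppr_gt0 ln_lt0// r0 r1.
exists (- ln r / (2 * rho.+1)%:R) => // G x y uG.
set C := _ / _ in C0 *.
have decay m : (dist1 x y <= 2 * rho.+1 * m)%N ->
    r ^+ m <= expR (- C * eucl_dist R x y).
  move=> xym; rewrite -[r]lnK ?posrE// -expRM_natl ler_expR.
  have -> : m%:R * ln r = - C * (2 * rho.+1 * m)%:R.
    rewrite /C natrM; have : (2 * rho.+1)%:R != 0 :> R by rewrite pnatr_eq0.
    by move: (2 * rho.+1)%:R => D D0; field.
  rewrite !mulNr lerN2 ler_wpM2l ?(ltW C0)//.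
  by apply: le_trans (eucl_dist_le_dist1 R x y) _; rewrite ler_nat.
have [xy0|xy0] := posnP (dist1 x y).
  apply: le_trans (decay 0%N _); rewrite ?xy0// expr0.
  by apply: perc_le1 => // w; exact: indic_le1.
(* The predecessor gives the strict inequality that the decay lemma requires. For positive [k] the
   distance is at most [k.+1 * rho.+1], hence at most [2 * rho.+1 * k]. *)
set k := ((dist1 x y).-1 %/ rho.+1)%N.
have kn : (k * rho.+1 < dist1 x y)%N.
  by rewrite -[ltnRHS](prednK xy0) ltnS leq_divM.
have nk : (dist1 x y <= k.+1 * rho.+1)%N.
  by rewrite -[leqLHS](prednK xy0) ltn_ceil.
have [k0|k0] := posnP k.
  apply: le_trans (decay 1%N _); last by rewrite muln1; move: nk; rewrite k0; lia.
  rewrite expr1; apply: (@le_trans _ _ t); last by rewrite !le_max lexx orbT.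
  apply: two_point_le => //.
  by move=> xy; move: xy0; rewrite xy /dist1 big1// => i _; rewrite subrr.
apply: le_trans (decay k _).
  apply: (@le_trans _ _ (phi ^+ k)).
    apply: (exponential_decay q0 q1' S0 S_rho liP lbP (lexx _)) => //.
    by move=> _ <-; rewrite dist1C.
  by rewrite lerXn2r ?nnegrE ?(ltW r0)// !le_max lexx.
by apply: leq_trans nk _; nia.
Qed.

(** * Gibbs measures *)

Section SpinSums.
Variables (R : comPzRingType) (T : finType).

Lemma wsum_ffun (l : seq T) (f : (T -> bool) -> R) (w : T -> bool) : uniq l ->
  wsum 1 1 l f w =
  \sum_(s : {ffun T -> bool} | [forall x, (x \notin l) ==> (s x == w x)]) f s.
Proof.
elim: l w => [w _|x l IH w /= /andP[xl ul]].
  rewrite /= (big_pred1 [ffun x => w x]).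
    by congr f; apply: funext => x; rewrite ffunE.
  move=> s; apply/forallP/eqP => [h|-> x]; last by rewrite ffunE eqxx ?implybT.
  by apply/ffunP => x; rewrite ffunE; apply/eqP; have := h x; rewrite ?implyTb.
rewrite !mul1r !IH// [RHS](bigID (fun s : {ffun T -> bool} => s x))/=.
have key b (s : {ffun T -> bool}) :
    [forall y, (y \notin l) ==> (s y == upd w x b y)] =
    [forall y, (y \notin x :: l) ==> (s y == w y)] && (s x == b).
  apply/forallP/andP => [h|[/forallP h /eqP sx] y].
    split; last by have := implyP (h x) xl; rewrite upd_same.
    apply/forallP => y; rewrite in_cons negb_or; apply/implyP => /andP[yx yl].
    by have := implyP (h y) yl; rewrite /upd (negPf yx).
  apply/implyP => yl; rewrite /upd; have [->|yx] := eqVneq y x; first by rewrite sx.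
  by apply: (implyP (h y)); rewrite in_cons negb_or yx.
by congr (_ + _); apply: eq_bigl => s; rewrite key ?eqb_id ?eqbF_neg.
Qed.

End SpinSums.

Section GibbsAsIsing.
Variables (R : realType) (d : nat) (L : {fset site d}).
Implicit Types (s : spins L) (eta : spins (ext_boundary L)).

Local Notation bsrc := (@bond_src d).
Local Notation btgt := (@bond_tgt d).

(** The common default [false] off the exterior boundary ensures that two boundary conditions
    disagree at most on that boundary. *)
Definition boundary_spins eta : site d -> bool :=
  fun x => if insub x : option (ext_boundary L) is Some v then eta v else false.

Definition extend_spins eta (s : L -> bool) : site d -> bool :=
  fun x => if insub x : option L is Some u then s u else boundary_spins eta x.

Lemma extend_in eta s (u : L) : extend_spins eta s (val u) = s u.
Proof. by rewrite /extend_spins valK. Qed.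

Lemma extend_out eta (s : L -> bool) x : x \notin L ->
  extend_spins eta s x = boundary_spins eta x.
Proof. by move=> xL; rewrite /extend_spins insubN. Qed.

Lemma sum_spins eta (F : (site d -> bool) -> R) :
  \sum_(s : spins L) F (extend_spins eta s) = wsum 1 1 L F (boundary_spins eta).
Proof.
pose w0 : L -> bool := fun=> false.
transitivity (wsum 1 1 (index_enum L) (fun v => F (extend_spins eta v)) w0).
  rewrite wsum_ffun; last exact: index_enum_uniq.
  apply: eq_bigl => s; apply/esym/forallP => x.
  by rewrite mem_index_enum.
transitivity (wsum 1 1 [seq val u | u <- index_enum L] F (extend_spins eta w0)).
  elim: (index_enum L) w0 => //= u l IH w0; rewrite !IH.
  have uE b : extend_spins eta (upd w0 u b) = upd (extend_spins eta w0) (val u) b.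
    apply: funext => x; rewrite /upd /extend_spins.
    case: insubP => [v xL <-|xL]; first by rewrite (inj_eq val_inj).
    by case: eqP => // xu; move: xL; rewrite xu (valP u).
  by rewrite !uE.
have pL : perm_eq [seq val u | u <- index_enum L] L.
  apply: uniq_perm; rewrite ?map_inj_uniq ?index_enum_uniq ?fset_uniq//.
  move=> x; apply/mapP/idP => [[u _ ->]|xL]; first exact: valP.
  by exists [` xL]%fset => //; rewrite mem_index_enum.
rewrite (perm_wsum _ _ _ _ pL); apply: (@wsum_depends _ _ _ _ _ (fun=> True)).
  by move=> v w vw; congr F; apply: funext => x; exact: vw.
by move=> x _ xL; exact: extend_out.
Qed.

Definition region_bonds : seq (bond d) := undup (flatten [seq star x | x <- L]).

Lemma mem_region_bonds e :
  (e \in region_bonds) = (bsrc e \in L) || (btgt e \in L).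
Proof.
rewrite mem_undup; apply/flatten_mapP/orP.
  by move=> [x xL]; rewrite mem_star => /orP[]/eqP ->; [left|right].
by move=> [eL|eL]; [exists (bsrc e)|exists (btgt e)]; rewrite // mem_star eqxx ?orbT.
Qed.

Lemma neighbours_perm (u : site d) :
  perm_eq (neighbours u) ([seq u + unit_vec i | i <- ord_enum d] ++
                          [seq u - unit_vec i | i <- ord_enum d]).
Proof.
have unit1 (i j : 'I_d) : unit_vec i ord0 j = (i == j)%:R :> int.
  by rewrite mxE eqxx /= eq_sym.
apply: uniq_perm; first exact: fset_uniq.
  rewrite cat_uniq !map_inj_uniq ?ord_enum_uniq/= ?andbT; first last.
  - move=> i j /addrI /rowP/(_ i); rewrite !unit1 eqxx.
    by case: eqP.
  - move=> i j /addrI /oppr_inj /rowP/(_ i); rewrite !unit1 eqxx.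
    by case: eqP.
  apply/hasPn => _ /mapP[i _ ->]; apply/mapP => -[j _ /addrI/rowP/(_ i)].
  rewrite mxE !unit1 eqxx.
  by case: eqP.
move=> x; rewrite in_fsetU mem_cat; congr (_ || _).
  by apply/imfsetP/mapP => [[i _ ->]|[i _ ->]]; exists i => //; exact: mem_ord_enum.
by apply/imfsetP/mapP => [[i _ ->]|[i _ ->]]; exists i => //; exact: mem_ord_enum.
Qed.

Lemma sum_neighbours (F : site d -> R) (u : site d) :
  \sum_(v <- neighbours u) F v =
  \sum_(e <- star u) F (if bsrc e == u then btgt e else bsrc e).
Proof.
rewrite (perm_big _ (neighbours_perm u)) /star !big_cat !big_map /=.
congr (_ + _); apply: eq_bigr => i _; rewrite /bond_src /bond_tgt /= ?eqxx//.
rewrite ifF//; apply/eqP => /rowP/(_ i) /eqP.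
by rewrite !mxE !eqxx -subr_eq0 addrAC subrr.
Qed.

(** Double counting: a bond belongs to the stars of its two distinct ends. *)
Lemma sum_star_region (F : bond d -> R) :
  \sum_(u <- L) \sum_(e <- star u) F e =
  \sum_(e <- region_bonds) F e *+ ((bsrc e \in L) + (btgt e \in L)).
Proof.
have st e : bsrc e != btgt e.
  apply/eqP => /rowP/(_ e.2) /eqP; rewrite !mxE !eqxx.
  by rewrite -subr_eq0 opprD addrA subrr.
transitivity (\sum_(u <- L) \sum_(e <- region_bonds | e \in star u) F e).
  rewrite !big_seq; apply: eq_bigr => u uL; rewrite -[RHS]big_filter.
  apply: perm_big; apply: uniq_perm; rewrite ?uniq_star ?filter_uniq ?undup_uniq//.
  move=> e; rewrite mem_filter mem_region_bonds mem_star.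
  by case: orP => // -[] /eqP ->; rewrite uL ?orbT.
rewrite (exchange_big_dep xpredT)//=; apply: eq_bigr => e _.
rewrite -[LHS]big_filter big_const_seq iter_addr_0 count_predT size_filter.
congr (_ *+ _).
have cE x : count (pred1 x) L = (x \in L) by rewrite count_uniq_mem.
rewrite -!cE; transitivity (count (predU (pred1 (bsrc e)) (pred1 (btgt e))) L).
  by apply: eq_count => x; rewrite /= mem_star ![_ == x]eq_sym.
rewrite -[LHS]addn0 -count_predUI; congr (_ + _)%N; apply/esym/eqP.
rewrite -leqn0 leqNgt -has_count; apply/hasPn => x _ /=.
by apply/negP => /andP[/eqP -> /eqP]; apply/eqP.
Qed.

Definition region_field (h : L -> R) (H : R) (x : site d) : R :=
  if insub x : option L is Some u then H * h u else 0.

Lemma gibbs_exponentE (h : L -> R) eta (beta H : R) s :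
  gibbs_exponent h eta beta H s =
  energy bsrc btgt beta L (region_field h H) region_bonds (extend_spins eta s).
Proof.
pose T x := spin R (extend_spins eta s x).
rewrite /gibbs_exponent /energy -mulrDr; congr (_ * _ + _); last first.
  rewrite big_seq_fsetE/= mulr_sumr; apply: eq_bigr => u _.
  by rewrite extend_in /region_field valK mulrA.
have swap (X N : {fset site d}) (P Q : pred (site d)) (F : site d -> R) :
    (forall v, (v \in X) && P v = (v \in N) && Q v) ->
    \sum_(v <- X | P v) F v = \sum_(v <- N | Q v) F v.
  move=> XN; rewrite -[LHS]big_filter -[RHS]big_filter; apply: perm_big.
  apply: uniq_perm; rewrite ?filter_uniq ?fset_uniq// => v.
  by rewrite !mem_filter andbC XN andbC.
have inner_sum (u : L) :
    \sum_(v : L | nn (val u) (val v)) spin R (s u) * spin R (s v) =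
    \sum_(v <- neighbours (val u) | v \in L) T (val u) * T v.
  rewrite -(swap L _ (nn (val u))) => [|v]; last by rewrite andbC.
  by rewrite big_seq_fsetE/=; apply: eq_bigr => v _; rewrite /T !extend_in.
have outer_sum (u : L) : \sum_(v : ext_boundary L | nn (val u) (val v))
      spin R (s u) * spin R (eta v) =
    \sum_(v <- neighbours (val u) | v \notin L) T (val u) * T v.
  rewrite -(swap (ext_boundary L) _ (nn (val u))) => [|v]; last first.
    apply/andP/andP => [[/mem_ext_boundary[-> _] uv]//|[uv vL]].
    split=> //; apply/mem_ext_boundary; split=> //.
    by exists (val u) => //; exact: valP.
  rewrite big_seq_fsetE/=; apply: eq_bigr => v _; rewrite /T extend_in extend_out.
    by rewrite /boundary_spins valK.
  by have /mem_ext_boundary[] := valP v.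
(* Bonds with both ends in [L] are met from either end, so they get weight 1/2; bonds to the
   boundary are met once. *)
pose F e := T (bsrc e) * T (btgt e) *
  (if (bsrc e \in L) && (btgt e \in L) then 2^-1 else 1).
transitivity (\sum_(u <- L) \sum_(e <- star u) F e); last first.
  rewrite sum_star_region !big_seq; apply: eq_bigr => e.
  rewrite mem_region_bonds /F -/(T _) -/(T _).
  case: (bsrc e \in L); case: (btgt e \in L) => //= _; rewrite ?mulr1//.
  by rewrite addn1 -mulrnAr -[2^-1 *+ 2]mulr_natr mulVf ?pnatr_eq0// mulr1.
under eq_bigr => u _ do rewrite inner_sum.
under [X in _ + X = _]eq_bigr => u _ do rewrite outer_sum.
rewrite mulr_sumr -big_split/= [RHS]big_seq_fsetE/=; apply: eq_bigr => u _.
rewrite mulr_sumr big_mkcond [X in _ + X]big_mkcond -big_split/=.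
rewrite (sum_neighbours (fun v => (if v \in L then 2^-1 * (T (val u) * T v) else 0) +
  (if v \notin L then T (val u) * T v else 0))).
apply: eq_big_seq => e; rewrite mem_star /F.
have uL : val u \in L by exact: valP.
case: eqP => [-> _|_ /= /eqP eu].
  by rewrite uL/=; case: ifP => _ /=; ring.
by rewrite eu uL andbT; case: ifP => _ /=; ring.
Qed.

End GibbsAsIsing.

(* Bounds the probability that a bond at a disagreeing spin is open; it is
   strictly smaller than [1 - exp (- 2 beta)]. *)
Definition disagreement_rate (R : realType) (d : nat) (beta H : R) : R :=
  let r := (expR (2 * beta) - 1) *
           (1 + expR (- (2 * (beta * (d.*2)%:R + H))))^-1 in
  r / (1 + r).

(** * From disagreement percolation to total variation *)

Section TotalVariation.
Variables (R : realType) (d : nat) (beta H q : R).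
Hypotheses (beta0 : 0 <= beta) (H0 : 0 <= H) (q1 : q <= 1).
Hypothesis beta_q : disagreement_rate d beta H <= q.

Local Notation bsrc := (@bond_src d).
Local Notation btgt := (@bond_tgt d).
Local Notation hits := (hits bsrc btgt).

Lemma disagreement_rate_ge0 : 0 <= q.
Proof.
have r0 : 0 <= (expR (2 * beta) - 1) *
           (1 + expR (- (2 * (beta * (d.*2)%:R + H))))^-1.
  apply: mulr_ge0; last by rewrite invr_ge0 addr_ge0 ?expR_ge0.
  by rewrite subr_ge0 -expR0 ler_expR mulr_ge0.
exact: le_trans (divr_ge0 r0 (addr_ge0 ler01 r0)) beta_q.
Qed.

Let q0 := disagreement_rate_ge0.

Lemma gibbs_marginalE (D L : {fset site d}) (sDL : (D `<=` L)%fset)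
    (h : L -> R) (eta : spins (ext_boundary L)) (A : {set spins D}) :
  gibbs_marginal sDL h eta beta H A =
  ising bsrc btgt beta L (region_field h H) (region_bonds L) L
    (fun s => ([ffun x : D => s (val x)] \in A)%:R) (boundary_spins eta).
Proof.
rewrite /gibbs_marginal /gibbs -mulr_suml /ising /partition_fn -!sum_spins.
congr (_ / _); last first.
  by apply: eq_bigr => s _; rewrite mul1r /gibbs_weight gibbs_exponentE.
rewrite big_mkcond; apply: eq_bigr => s _; rewrite -gibbs_exponentE.
rewrite (_ : [ffun _ => _] = restrict_spins sDL s).
  by case: (_ \in A); rewrite ?mul1r ?mul0r.
apply/ffunP => x; rewrite !ffunE.
exact: (extend_in eta s (fincl sDL x)).
Qed.

Lemma gibbs_marginal_dist (D L : {fset site d}) (sDL : (D `<=` L)%fset)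
    (h : L -> R) (eta eta' : spins (ext_boundary L)) (A : {set spins D}) :
  (forall u, `|H * h u| <= H) ->
  `|gibbs_marginal sDL h eta beta H A - gibbs_marginal sDL h eta' beta H A| <=
  perc q (region_bonds L) (fun w =>
    indic R (hits w (fun x => x \in ext_boundary L) (fun x => x \in D))).
Proof.
move=> hH; rewrite !gibbs_marginalE.
apply: (@disagreement_percolation _ _ _ _ _ _ _ _ _ _
  (beta * (d.*2)%:R + H)) => //.
- exact: fset_uniq.
- by move=> s; case: (_ \in A); rewrite ?lexx ler01.
- move=> v w vw; congr ((_ \in A)%:R); apply/ffunP => x; rewrite !ffunE.
  by apply: vw; exact: valP.
- move=> u; apply: lerD.
    by rewrite ler_wpM2l// ler_nat count_incident_le// undup_uniq.
  rewrite /region_field; case: insubP => [v _ _|uL]; first exact: hH.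
  by rewrite normr0.
- exact: undup_uniq.
- exact: fset_uniq.
- by move=> x /mem_ext_boundary[].
- by move=> x xL; rewrite /boundary_spins insubN//; exact/negP.
Qed.

(** A path from the boundary of [L] first enters [D] from a vertex of the exterior boundary of
    [D]. *)
Lemma hits_region (D L : {fset site d}) w : (D `<=` L)%fset ->
  hits w (fun x => x \in ext_boundary L) (fun x => x \in D) ->
  exists2 x, x \in ext_boundary D &
    exists2 y, y \in ext_boundary L & hits w (eq y) (eq x).
Proof.
move=> sDL [z zD /conn_single[y yL yz]].
have [|e [a [b [aD bD eab _ ya]]]] :=
  conn_exit (B := fun x => x \notin D) _ yz (fun zD' => elimT negP zD' zD).
  move=> _ <-; apply/negP => /(fsubsetP sDL).
  by apply/negP; have /mem_ext_boundary[] := yL.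
exists a; last first.
  by exists y => //; exists a => //; apply: conn_mono ya => f /andP[].
apply/mem_ext_boundary; split=> //; exists b; first by apply: contrapT => /negP.
rewrite /nn (perm_mem (neighbours_perm b)) mem_cat.
case: eab => -[<- <-]; apply/orP; [right|left]; apply/mapP; exists e.2.
- exact: mem_ord_enum.
- by rewrite /bond_tgt addrK.
- exact: mem_ord_enum.
- by [].
Qed.

Lemma max_bc_tv_le (C : R) (D L : {fset site d}) (sDL : (D `<=` L)%fset)
    (h : L -> R) :
  (forall (G : seq (bond d)) x y, uniq G ->
    perc q G (fun w => indic R (hits w (eq y) (eq x))) <=
    expR (- C * eucl_dist R x y)) ->
  (forall u, `|H * h u| <= H) ->
  max_bc_tv sDL h beta H <=
  \sum_(x <- ext_boundary D) \sum_(y <- ext_boundary L)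
    expR (- C * eucl_dist R x y).
Proof.
move=> decay hH; set bound := leRHS.
have bound0 : 0 <= bound.
  by rewrite sumr_ge0// => x _; rewrite sumr_ge0// => y _; exact: expR_ge0.
apply: bigmax_le => // eta _; apply: bigmax_le => // eta' _.
apply: bigmax_le => // A _; apply: le_trans (gibbs_marginal_dist _ _ _ _ hH) _.
(* Union bound over the pairs of boundary vertices that may be connected. *)
apply: (@le_trans _ _ (\sum_(x <- ext_boundary D) \sum_(y <- ext_boundary L)
    perc q (region_bonds L) (fun w => indic R (hits w (eq y) (eq x))))); last first.
  by apply: ler_sum => x _; apply: ler_sum => y _; apply: decay; exact: undup_uniq.
under eq_bigr do rewrite /perc -wsum_sum.
rewrite -wsum_sum; apply: ler_wsum; rewrite ?subr_ge0// => w.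
set S := leRHS; have S0 : 0 <= S.
  by apply: sumr_ge0 => x _; apply: sumr_ge0 => y _; exact: indic_ge0.
have [hw|hw] := pselect (hits w (fun x => x \in ext_boundary L) (fun x => x \in D));
  last by rewrite indic_false.
have [x xD [y yL xy]] := hits_region sDL hw; rewrite indic_true//.
rewrite /S (big_rem x)//= ler_wpDr//.
  by apply: sumr_ge0 => x' _; apply: sumr_ge0 => y' _; exact: indic_ge0.
rewrite (big_rem y)//= indic_true// ler_wpDr//.
by apply: sumr_ge0 => y' _; exact: indic_ge0.
Qed.

End TotalVariation.

(** * Vanishing of the magnetization *)

Section Magnetization.
Variables (R : realType) (d : nat) (beta q : R).
Hypotheses (beta0 : 0 <= beta) (q1 : q < 1).
Hypothesis beta_q : disagreement_rate d beta 0 <= q.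
Hypothesis critq : finite_size_criterion d q.

Definition flip_spins (L : {fset site d}) (s : spins L) : spins L :=
  [ffun x => ~~ s x].

Lemma flip_spinsK (L : {fset site d}) : involutive (@flip_spins L).
Proof. by move=> s; apply/ffunP => x; rewrite !ffunE negbK. Qed.

Lemma gibbs_flip (L : {fset site d}) (eta : spins (ext_boundary L)) s :
  gibbs (fun=> 0) (flip_spins eta) beta 0 (flip_spins s) =
  gibbs (fun=> 0) eta beta (0 : R) s.
Proof.
have spinN (b : bool) : spin R (~~ b) = - spin R b.
  by case: b; rewrite /spin ?opprK.
have weight t : gibbs_weight (fun=> 0) (flip_spins eta) beta 0 (flip_spins t) =
    gibbs_weight (fun=> 0) eta beta (0 : R) t.
  rewrite /gibbs_weight; apply: congr1; rewrite /gibbs_exponent !mul0r !addr0.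
  congr (_ + _); apply: congr1; last first.
    by apply: eq_bigr => u _; apply: eq_bigr => v _; rewrite !ffunE !spinN mulrNN.
  apply: congr1.
  by apply: eq_bigr => u _; apply: eq_bigr => v _; rewrite !ffunE !spinN mulrNN.
rewrite /gibbs weight; congr (_ / _).
rewrite (reindex_inj (inv_inj (@flip_spinsK L))).
by apply: eq_bigr => t _; exact: weight.
Qed.

(** By spin-flip symmetry the magnetization is the difference, between plus and minus boundary
    conditions, of the probabilities of an up spin at the origin, to which disagreement percolation
    applies. *)
Lemma plus_magnetization_le n :
  `|plus_magnetization d beta n| <=
  perc q (region_bonds (box d n)) (fun w => indic R
    (hits (@bond_src d) (@bond_tgt d) w
      (fun x => x \in ext_boundary (box d n)) (fun x => x \in [fset 0]%fset))).
Proof.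
set o := [` origin_box d n]%fset.
have sDL : ([fset (0 : site d)] `<=` box d n)%fset.
  by rewrite fsub1set origin_box.
pose D := [fset (0 : site d)]%fset.
have oD : (0 : site d) \in D by rewrite in_fset1.
pose plus : spins (ext_boundary (box d n)) := [ffun=> true].
pose A : {set spins D} := [set t : spins D | t [` oD]%fset]%SET.
have restrict0 s : (restrict_spins sDL s \in A) = s o.
  by rewrite inE ffunE; congr (s _); exact: val_inj.
pose m eta := \sum_(s : spins (box d n))
  gibbs (fun=> 0) eta beta 0 s * spin R (s o).
have mE eta : m eta =
    2 * gibbs_marginal sDL (fun=> 0) eta beta 0 A - 1.
  rewrite -[X in _ - X](gibbs_sum1 (fun=> 0 : R) eta beta 0).
  rewrite /gibbs_marginal mulr_sumr.
  rewrite [X in X - _]big_mkcond -sumrB; apply: eq_bigr => s _.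
  by rewrite restrict0 /spin; case: (s o); ring.
have mflip : m (flip_spins plus) = - m plus.
  rewrite /m (reindex_inj (inv_inj (@flip_spinsK _))) -sumrN.
  apply: eq_bigr => s _; rewrite gibbs_flip ffunE -mulrN; congr (_ * _).
  by rewrite /spin; case: (s o); rewrite ?opprK.
rewrite (_ : plus_magnetization d beta n = m plus)//.
have -> : m plus = gibbs_marginal sDL (fun=> 0) plus beta 0 A -
    gibbs_marginal sDL (fun=> 0) (flip_spins plus) beta 0 A.
  by move: mflip; rewrite !mE; lra.
apply: gibbs_marginal_dist => //; first exact: ltW.
by move=> u; rewrite mulr0 normr0.
Qed.

Lemma plus_magnetization_cvg :
  (plus_magnetization d beta n @[n --> \oo] --> (0 : R))%classic.
Proof.
have rate_ge0 : 0 <= q.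
  exact: disagreement_rate_ge0 beta0 beta_q.
have q1' := ltW q1.
have [S [rho [li [lb [S0 S_rho liP lbP]]]]] := critq.
set phi := q * _ => phi1.
have phi0 : 0 <= phi.
  rewrite mulr_ge0// sumr_ge0// => e _.
  by apply: perc_ge0 => // w; exact: indic_ge0.
have small k n : (k * rho.+1 <= n)%N -> `|plus_magnetization d beta n| <= phi ^+ k.
  move=> kn; apply: le_trans (plus_magnetization_le n) _.
  apply: le_trans (exponential_decay rate_ge0 q1' S0 S_rho liP lbP (lexx _)
    (k := k) (y := 0) (D := fun x => x \in ext_boundary (box d n))
    (undup_uniq _) _).
    apply: ler_perc => // w; apply: indic_le => -[z].
    rewrite in_fset1 => /eqP -> /conn_single[a aB a0].
    by exists a => //; exact: conn_sym.
  move=> z /mem_ext_boundary[zn _]; rewrite ltnNge; apply/negP => zk.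
  by move/negP: zn; apply; apply: dist1_box; exact: leq_trans kn.
apply/cvgrPdist_le => /= eps eps0.
have [k _ kP] : \forall k \near \oo%classic, phi ^+ k <= eps.
  have /cvgrPdist_le/(_ _ eps0) : (phi ^+ k @[k --> \oo] --> (0 : R))%classic.
    by apply: cvg_expr; rewrite ger0_norm.
  by apply: filterS => k; rewrite sub0r normrN ger0_norm// exprn_ge0.
exists (k * rho.+1)%N => // n /= kn; rewrite sub0r normrN.
by apply: le_trans (small _ _ kn) _; apply: kP => /=.
Qed.

End Magnetization.

(** * Thresholds *)

Section Thresholds.
Variables (R : realType) (d : nat).
Hypothesis d_gt0 : (0 < d)%N.

(** This form makes monotonicity visible and compares directly with [1 - expR (- (2 * beta))]. *)
Lemma disagreement_rateE (beta H : R) : 0 <= beta ->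
  disagreement_rate d beta H = 1 - (1 + (expR (2 * beta) - 1) *
    (1 + expR (- (2 * (beta * (d.*2)%:R + H))))^-1)^-1.
Proof.
move=> b0; pose r : R := (expR (2 * beta) - 1) *
  (1 + expR (- (2 * (beta * (d.*2)%:R + H))))^-1.
have r0 : 0 <= r.
  apply: mulr_ge0; last by rewrite invr_ge0 addr_ge0 ?expR_ge0.
  by rewrite subr_ge0 -expR0 ler_expR mulr_ge0.
have r1 : 1 + r != 0 by rewrite gt_eqF// ltr_pwDl.
rewrite -/r; change (r / (1 + r) = 1 - (1 + r)^-1).
by move: r r0 r1 => r _ r1; field.
Qed.

Lemma disagreement_rate_mono (beta beta' H H' : R) : 0 <= beta ->
  beta <= beta' -> H <= H' ->
  disagreement_rate d beta H <= disagreement_rate d beta' H'.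
Proof.
move=> b0 bb HH; rewrite !disagreement_rateE ?(le_trans b0)//.
have pos (b h : R) : 0 < (1 + expR (- (2 * (b * (d.*2)%:R + h)))).
  by rewrite addr_gt0 ?expR_gt0.
have r0 b h : 0 <= b -> 0 < 1 + (expR (2 * b) - 1) *
    (1 + expR (- (2 * (b * (d.*2)%:R + h))))^-1.
  move=> b0'; rewrite ltr_pwDl// mulr_ge0 ?invr_ge0 ?(ltW (pos _ _))//.
  by rewrite subr_ge0 -expR0 ler_expR mulr_ge0.
rewrite lerD2l lerN2 lef_pV2 ?posrE ?r0 ?(le_trans b0)//.
rewrite lerD2l; apply: ler_pM.
- by rewrite subr_ge0 -expR0 ler_expR mulr_ge0.
- by rewrite invr_ge0 ltW.
- by rewrite lerD2r ler_expR ler_wpM2l.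
- rewrite lef_pV2 ?posrE// lerD2l ler_expR lerN2 ler_wpM2l// lerD//.
  by rewrite ler_wpM2r.
Qed.

(** Below the second entry the criterion holds with [S] a point; it keeps the threshold positive
    without any lower bound on [p_c]. *)
Definition critical_rate : R := Num.max (p_c R d) ((d.*2)%:R)^-1.

Lemma finite_size_criterion_below (p : R) : 0 <= p -> p < critical_rate ->
  exists q, [/\ p <= q, q < 1 & finite_size_criterion d q].
Proof.
move=> p0; rewrite lt_max => /orP[|pd].
  exact: finite_size_criterion_subcritical.
have d2 : 0 < (d.*2)%:R :> R by rewrite ltr0n double_gt0.
have p1 : p < 1.
  apply: lt_le_trans pd _; rewrite invf_le1// ler1n.
  by rewrite double_gt0.
exists p; split=> //; apply: finite_size_criterion_small => //; first exact: ltW.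
by rewrite -ltr_pdivlMr// mul1r.
Qed.

Lemma p_c_ge0 : 0 <= p_c R d.
Proof.
rewrite /p_c; set U := [set p | _]%classic.
have [|U0] := pselect (U !=set0)%classic.
  move=> [p Up]; have /andP[p0 _] := Up.1.
  apply: le_trans p0 _; apply: ub_le_sup => //.
  by exists 1 => r [/andP[]].
have -> : U = set0 by apply/seteqP; split=> // x Ux; apply: U0; exists x.
by rewrite sup0.
Qed.

Lemma beta_P_fin : p_c R d < 1 ->
  beta_P R d = (- (2^-1 * ln (1 - p_c R d)))%:E.
Proof. by move=> pc1; rewrite /beta_P lne_EFin ?subr_gt0. Qed.

Lemma beta_P_pinfty : p_c R d = 1 -> beta_P R d = +oo%E.
Proof.
move=> pc1; rewrite /beta_P pc1 subrr le0_lneNy ?lexx//.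
by rewrite mulrNy gtr0_sg ?invr_gt0// mul1e.
Qed.

(* The finite energy property of the spins makes the rate strictly smaller than
   [1 - exp (- 2 beta)], so that there is room even at [beta = beta_P]. *)
Lemma disagreement_rate_lt (beta H : R) : 0 <= beta ->
  (beta%:E <= beta_P R d)%E -> disagreement_rate d beta H < critical_rate.
Proof.
move=> b0 bP; rewrite lt_max.
have [b_gt0|b_le0] := ltP 0 beta; last first.
  have -> : beta = 0 by apply/eqP; rewrite eq_le b_le0 b0.
  rewrite /disagreement_rate mulr0 expR0 subrr !mul0r invr_gt0 ltr0n double_gt0.
  by rewrite d_gt0 orbT.
apply/orP; left.
have lt_p : disagreement_rate d beta H < 1 - expR (- (2 * beta)).
  rewrite disagreement_rateE// (expRN (2 * beta)) ltrD2l ltrN2.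
  set E := expR (2 * beta).
  have E1 : 1 < E by rewrite /E -expR0 ltr_expR mulr_gt0.
  set k := (1 + expR _)^-1.
  have k0 : 0 < k by rewrite invr_gt0 addr_gt0 ?expR_gt0.
  have k1 : k < 1.
    by rewrite invf_lt1 ?addr_gt0 ?expR_gt0// ltrDl expR_gt0.
  have Ek0 : 0 < (E - 1) * k by rewrite mulr_gt0// subr_gt0.
  rewrite ltf_pV2 ?posrE ?expR_gt0 ?addr_gt0//.
  by rewrite -ltrBrDl gtr_pMr// subr_gt0.
apply: lt_le_trans lt_p _.
have := p_c_le1 R d; rewrite le_eqVlt => /orP[/eqP ->|pc1].
  by rewrite gerBl expR_ge0.
move: bP; rewrite beta_P_fin// lee_fin => bP.
rewrite lerBlDr -lerBlDl -[leLHS]lnK ?posrE ?subr_gt0// ler_expR; lra.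
Qed.

Lemma disagreement_rate_cvg (b : R) : 0 <= b ->
  (disagreement_rate d x 1 @[x --> b] --> disagreement_rate d b 1)%classic.
Proof.
move=> b0.
have c_id : (x @[x --> b] --> b)%classic by exact: cvg_id.
have c_exp (f : R -> R) : (f x @[x --> b] --> f b)%classic ->
    (expR (f x) @[x --> b] --> expR (f b))%classic.
  by move=> fb; apply: continuous_cvg => //; exact: continuous_expR.
have c_r : ((expR (2 * x) - 1) * (1 + expR (- (2 * (x * (d.*2)%:R + 1))))^-1
    @[x --> b] --> (expR (2 * b) - 1) *
      (1 + expR (- (2 * (b * (d.*2)%:R + 1))))^-1)%classic.
  apply: cvgM.
    apply: cvgB; last exact: cvg_cst.
    by apply: c_exp; apply: cvgM => //; exact: cvg_cst.
  apply: cvgV; first by rewrite gt_eqF// addr_gt0 ?expR_gt0.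
  apply: cvgD; first exact: cvg_cst.
  apply: c_exp; apply: cvgN; apply: cvgM; first exact: cvg_cst.
  by apply: cvgD; [apply: cvgM => //; exact: cvg_cst|exact: cvg_cst].
apply: cvgM => //; apply: cvgV; last by apply: cvgD => //; exact: cvg_cst.
rewrite gt_eqF// ltr_pwDl//; apply: mulr_ge0.
  by rewrite subr_ge0 -expR0 ler_expR mulr_ge0.
by rewrite invr_ge0 addr_ge0 ?expR_ge0.
Qed.

(** The strict inequality at [b] persists nearby by continuity. The margin [2 * eps] rather than
    [eps] later makes [beta_P + eps] strictly smaller than [beta_c]. *)
Lemma disagreement_rate_eps (b : R) : beta_P R d = b%:E ->
  exists2 eps, 0 < eps & disagreement_rate d (b + 2 * eps) 1 < critical_rate.
Proof.
move=> bE.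
have b0 : 0 <= b.
  have [pc1|] := ltP (p_c R d) 1; last first.
    rewrite le_eqVlt => /orP[/eqP/esym/beta_P_pinfty|]; first by rewrite bE.
    by rewrite ltNge p_c_le1.
  move: bE; rewrite beta_P_fin// => -[<-]; rewrite oppr_ge0 pmulr_rle0//.
  by apply: ln_le0; rewrite gerBl p_c_ge0.
have bb : (b%:E <= beta_P R d)%E by rewrite bE.
have [e /= e0 He] := cvgr_lt _ (disagreement_rate_cvg b0) _
  (disagreement_rate_lt 1 b0 bb).
(* [2 * (e / 4)] is strictly less than the radius [e]. *)
exists (e / 4); first by rewrite divr_gt0.
apply: He; rewrite /ball_/= opprD addrA subrr sub0r normrN gtr0_norm; lra.
Qed.

Lemma decay_below_critical_rate (beta H : R) : 0 <= beta -> 0 <= H ->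
  disagreement_rate d beta H < critical_rate ->
  exists C1 : R, 0 < C1 /\
    forall (D L : {fset site d}) (sDL : (D `<=` L)%fset) (h : L -> R),
      (forall u, h u = 1 \/ h u = -1) ->
      max_bc_tv sDL h beta H <=
        \sum_(x <- ext_boundary D) \sum_(y <- ext_boundary L)
          expR (- C1 * eucl_dist R x y).
Proof.
move=> b0 H0 rate.
have rate0 := disagreement_rate_ge0 b0 (lexx (disagreement_rate d beta H)).
have [q [rq q1 crit]] := finite_size_criterion_below rate0 rate.
have [C C0 decay] := two_point_decay (le_trans rate0 rq) q1 crit.
exists C; split=> // D L sDL h hpm.
apply: (max_bc_tv_le b0 H0 (ltW q1) rq) => [G x y uG|u]; first exact: decay.
by rewrite normrM ger0_norm//; case: (hpm u) => ->; rewrite ?normrN normr1 mulr1.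
Qed.

Lemma spontaneous_magnetization_eq0 (beta : R) : 0 <= beta ->
  disagreement_rate d beta 0 < critical_rate ->
  spontaneous_magnetization d beta = 0.
Proof.
move=> b0 rate.
have rate0 := disagreement_rate_ge0 b0 (lexx (disagreement_rate d beta 0)).
have [q [rq q1 crit]] := finite_size_criterion_below rate0 rate.
by apply: cvg_lim => //; exact: plus_magnetization_cvg b0 q1 rq crit.
Qed.

End Thresholds.

Theorem theorem3 (R : realType) (d : nat) (d_gt0 : (0 < d)%N) :
  exists (eps : R) (H1 : R -> \bar R),
    0 < eps /\
    ((beta_P R d < +oo)%E -> (beta_P R d + eps%:E < beta_c R d)%E) /\
    (forall beta : R, 0 <= beta -> (beta%:E < beta_c R d)%E ->
       ((beta%:E <= beta_P R d)%E -> H1 beta = +oo%E) /\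
       ((beta_P R d < beta%:E <= beta_P R d + eps%:E)%E ->
          (0 < H1 beta < +oo)%E) /\
       ((beta_P R d + eps%:E < beta%:E)%E -> (0 <= H1 beta < +oo)%E)) /\
    (forall beta H : R, 0 <= beta -> (beta%:E < beta_c R d)%E ->
       0 <= H -> (H%:E < H1 beta)%E ->
       exists C1 : R, 0 < C1 /\
         forall (D L : {fset site d}) (sDL : (D `<=` L)%fset) (h : L -> R),
           (forall u, h u = 1 \/ h u = -1) ->
           max_bc_tv sDL h beta H <=
             \sum_(x <- ext_boundary D) \sum_(y <- ext_boundary L)
               expR (- C1 * eucl_dist R x y)).
Proof.
have [eps eps0 eps_rate] : exists2 eps : R, 0 < eps & forall b,
    beta_P R d = b%:E -> disagreement_rate d (b + 2 * eps) 1 < critical_rate R d.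
  have [[b bE]|nb] := pselect (exists b, beta_P R d = b%:E).
    have [eps eps0 Heps] := disagreement_rate_eps d_gt0 bE.
    by exists eps => // b'; rewrite bE => -[<-].
  by exists 1 => // b bE; case: nb; exists b.
have [bP_inf|[b bE]] : beta_P R d = +oo%E \/ exists b, beta_P R d = b%:E.
- have := p_c_le1 R d; rewrite le_eqVlt.
  case/orP => [/eqP/beta_P_pinfty|/beta_P_fin]; first by left.
  by move=> ->; right; eexists.
(* With infinite [beta_P] every [beta] and [H] has a rate below the critical one, so the field
   threshold is infinite throughout. *)
- exists eps, (fun=> +oo%E); rewrite bP_inf; split=> //; split; first by [].
  split; first by move=> beta _ _; rewrite leey; do 2?[split].
  move=> beta H b0 _ H0 _; apply: decay_below_critical_rate => //.
  by apply: disagreement_rate_lt => //; rewrite bP_inf leey.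
(* The value 1 is the field strength at which [eps] was chosen; the value 0 makes the decay claim
   vacuous. *)
pose H1 (beta : R) : \bar R := if beta <= b then +oo%E
  else if beta <= b + eps then 1%E else 0%E.
exists eps, H1; rewrite bE; split=> //; split.
  move=> _; apply: (@lt_le_trans _ _ (b + 2 * eps)%:E).
    by rewrite -EFinD lte_fin; lra.
  (* A positive magnetization below [b + 2 * eps] is impossible: there the rate at zero field is at
     most its value at [b + 2 * eps] and field 1, hence subcritical. *)
  apply: le_ereal_inf_tmp => _ [beta [beta0 magn] <-]; rewrite lee_fin.
  rewrite leNgt; apply/negP => beta_lt; move: magn.
  rewrite (spontaneous_magnetization_eq0 d_gt0 beta0) ?ltxx//.
  apply: le_lt_trans (eps_rate _ bE).
  by apply: disagreement_rate_mono => //; exact: ltW.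
split.
  move=> beta beta0 _; rewrite /H1 -EFinD !lee_fin !lte_fin.
  split; first by move=> ->.
  split.
    by move=> /andP[bb bbe]; rewrite leNgt bb/= bbe ltry lte_fin ltr01.
  move=> bbe; have -> : (beta <= b) = false by apply/negbTE; rewrite -ltNge; lra.
  have -> : (beta <= b + eps) = false by apply/negbTE; rewrite -ltNge.
  by rewrite lexx ltry.
move=> beta H beta0 _ H0; rewrite /H1 => HH; apply: decay_below_critical_rate => //.
case: ifP HH => [bb _|_].
  by apply: disagreement_rate_lt => //; rewrite bE lee_fin.
case: ifP => [bb|_]; rewrite lte_fin; last by rewrite ltNge H0.
move=> HH; apply: le_lt_trans (eps_rate _ bE).
by apply: disagreement_rate_mono => //; [lra|exact: ltW].
Qed.
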